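(* (i) For every integer $k\geq 1$, $$\sum_{n\geq 0}\frac{\left[\frac{1}{4^n}\binom{2n}{n}\right]^3}{(n+1)_k\left(\frac{1}{2}-n\right)_k} = \frac{\Gamma\left(\frac{1}{4}\right)^2}{2\pi\sqrt{2}}\cdot \frac{\Gamma\left(k+\tfrac{1}{4}\right)}{\Gamma\left(k+\tfrac{1}{2}\right)^2\,\Gamma\left(k+\tfrac{3}{4}\right)},$$ $$\sum_{n\geq 0}\frac{\left[\frac{1}{4^n}\binom{2n}{n}\right]^2}{(n+1)_k\left(\frac{1}{2}-n\right)_k} = \frac{2^{8k-3}\,\Gamma(k)^2}{\pi\,\Gamma(4k)}.$$ (ii) Additionally, let $p(x)\in\mathbb{Z}[x]$ be a monic polynomial with even degree, with simple roots belonging to the set $\left\{\ldots,-3,-2,-1,\tfrac12,\tfrac32,\tfrac52,\ldots\right\}$, and such that $p(x)=p\left(-\tfrac12-x\right)$. Then $$ \sum_{n\geq 0}\frac{1}{p(n)}\left[\frac{1}{4^n}\binom{2n}{n}\right]^3 $$ is a rational multiple of $\frac{\Gamma\left(\frac{1}{4}\right)^4}{8\pi^3}$, and $$ \sum_{n\geq 0}\frac{1}{p(n)}\left[\frac{1}{4^n}\binom{2n}{n}\right]^2 $$ is a rational multiple of $\frac{1}{\pi}$.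
   Context: $(a)_k=\Gamma(a+k)/\Gamma(a)=a(a+1)\cdots(a+k-1)$ denotes the rising Pochhammer symbol and $\Gamma$ the Euler Gamma function. The set of admissible roots in (ii) consists of all negative integers together with all positive half-integers $\tfrac12,\tfrac32,\tfrac52,\ldots$. A rational multiple of a real number $c$ means a number of the form $qc$ with $q\in\mathbb{Q}$.
   Formalization: In (ii), p is monic with rational instead of integer coefficients (over Z only p = 1 meets the conditions), and the claim on the squares is stated only for p of positive degree, because for p = 1 that series diverges. *)

(* Defs.v *)
From HB Require Import structures.
From mathcomp Require Import all_boot all_order all_algebra all_field.
From mathcomp Require Import all_classical all_reals all_analysis.

Set Implicit Arguments.
Unset Strict Implicit.
Unset Printing Implicit Defensive.

Import Order.TTheory GRing.Theory Num.Theory.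
Import numFieldNormedType.Exports.

Local Open Scope classical_set_scope.
Local Open Scope ring_scope.

(* Euler's integral; this is the Gamma function for 0 < x only, and it is used
   only there. *)
Definition Gamma (R : realType) (x : R) : R :=
  \int[lebesgue_measure]_(t in `]0, +oo[) (t `^ (x - 1) * expR (- t)).

(* The rising factorial (a)_k, as a product so that it also makes sense for
   negative a. *)
Definition pochhammer (R : realType) (a : R) (k : nat) : R :=
  \prod_(i < k) (a + i%:R).

Definition central_ratio (R : realType) (n : nat) : R :=
  'C(n.*2, n)%:R / 4 ^+ n.

Definition admissible_root (z : algC) : Prop :=
  (exists m : nat, z = - m.+1%:R) \/ (exists m : nat, z = m%:R + 2^-1).

(* The roots are the complex ones: algC contains all complex roots of a
   nonzero rational polynomial. *)
Definition simple_admissible_roots (p : {poly rat}) : Prop :=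
  let pC := map_poly (ratr : rat -> algC) p in
  forall z : algC, root pC z -> mup z pC = 1%N /\ admissible_root z.

Definition sums_to_rational_multiple (R : realType) (u : nat -> R) (c : R)
    : Prop :=
  exists q : rat, series u @ \oo --> ratr q * c.

(* Main.v *)
(* Write [b n] for the central ratio. Both families of series in (i) satisfy
   first order recurrences in [k], certified by Wilf-Zeilberger pairs, so each
   family is determined by one value. For the squares the case [k = 1]
   telescopes and Wallis' limit [n * b n ^ 2 --> 1 / pi] gives [16 / (3 * pi)].
   For the cubes the case [k = 0] is the sum of [b n ^ 3], an instance of
   Dixon's theorem: embedded in the series with terms
   [(a)_n (1/2)_n^2 / (n! (a + 1/2)_n^2)] at [a = 1/2], it is related by another
   Wilf-Zeilberger pair to the series at [a + 2 m], whose sum tends to [1].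
   The resulting infinite products are evaluated by the log-convexity of Gamma
   and [Gamma (1/2) ^ 2 = pi], which also yield Wallis' limit and the value of
   [Gamma (1/4) * Gamma (3/4)].

   For (ii), the symmetry pairs the root [- (m + 1)] with [m + 1/2], so [p] is a
   product of distinct factors [y - d_m] with [y = x^2 + x / 2]. Partial
   fractions in [y] reduce the claim to single factors, and these are obtained,
   again by partial fractions, from the products over [m < k] treated in (i). *)
Require Import Defs.
From HB Require Import structures.
From mathcomp Require Import all_boot all_order all_algebra all_field.
From mathcomp Require Import all_classical all_reals all_analysis.
From mathcomp Require Import measurable_realfun ring lra zify.

Set Implicit Arguments.
Unset Strict Implicit.
Unset Printing Implicit Defensive.

Import Order.TTheory GRing.Theory Num.Theory.
Import numFieldNormedType.Exports.

Local Open Scope classical_set_scope.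
Local Open Scope ring_scope.

(** * The central binomial ratio and its decay *)

Lemma central_ratio0 (R : realType) : central_ratio R 0 = 1.
Proof. by rewrite /central_ratio bin0 expr0 divr1. Qed.

Lemma central_ratioS (R : realType) n :
  central_ratio R n.+1 =
  central_ratio R n * ((n%:R + 2^-1) / (n%:R + 1)).
Proof.
have n1 : (n%:R + 1 : R) != 0 by rewrite natr1 pnatr_eq0.
have E : ('C(n.+1.*2, n.+1) * n.+1 = 'C(n.*2, n) * (2 * n.*2.+1))%N.
  have H := mul_bin_diag n.*2.+1 n.
  (* The two middle entries of an odd row of Pascal's triangle agree, so Pascal's rule doubles one
     of them. *)
  have C : 'C(n.*2.+1, n.+1) = 'C(n.*2.+1, n).
    by rewrite -bin_sub -?addnn; [congr 'C(_, _); lia | lia].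
  rewrite doubleS binS -C addnn -mul2n -mulnA (mulnC _ n.+1) -H /=.
  by rewrite mulnA mulnC.
rewrite /central_ratio exprS.
have := congr1 (fun x => x%:R : R) E; rewrite !natrM -(natr1 n) -(natr1 n.*2) => E'.
have f4 : (4 ^+ n : R) != 0 by rewrite expf_neq0.
have -> : ('C(n.+1.*2, n.+1)%:R : R) =
  'C(n.*2, n)%:R * (2 * (n.*2%:R + 1)) / (n%:R + 1).
  by rewrite -E' mulfK.
by rewrite -mul2n natrM; field; rewrite f4 n1.
Qed.

Lemma central_ratio_gt0 (R : realType) n : 0 < central_ratio R n.
Proof.
elim: n => [|n IH]; first by rewrite central_ratio0.
by rewrite central_ratioS mulr_gt0// divr_gt0// ltr_wpDl.
Qed.

(** Induction through (n + 1/2)^2 (n + 2) <= (n + 1)^3. This crude form of Wallis' asymptotics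
    supplies the decay of [b n] in the estimates below. *)
Lemma central_ratio_sqr_le (R : realType) n :
  central_ratio R n ^+ 2 * (n%:R + 1) <= 1.
Proof.
elim: n => [|n IH]; first by rewrite central_ratio0 expr1n add0r mulr1.
apply: le_trans IH; rewrite central_ratioS exprMn -mulrA ler_wpM2l ?sqr_ge0//.
rewrite -(natr1 n) expr_div_n mulrAC ler_pdivrMr ?exprn_gt0 ?ltr_wpDl//.
have : 0 <= n%:R :> R by []. set x := n%:R => x0. nra.
Qed.

Lemma cvg_central_ratio (R : realType) : central_ratio R @ \oo --> (0 : R).
Proof.
have sq : (fun n => central_ratio R n ^+ 2) @ \oo --> (0 : R).
  apply: (@squeeze_cvgr _ _ _ _ (cst 0) (@harmonic R)); last 2 first.
  - exact: cvg_cst.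
  - exact: cvg_harmonic.
  apply: nearW => n; rewrite sqr_ge0/= /harmonic -[leRHS]mul1r ler_pdivlMr//.
  by rewrite -natr1 central_ratio_sqr_le.
have : (fun n => Num.sqrt (central_ratio R n ^+ 2)) @ \oo --> Num.sqrt (0 : R).
  by apply: continuous_cvg => //; exact: sqrt_continuous.
rewrite sqrtr0; apply: cvg_trans; apply: near_eq_cvg; apply: nearW => n.
by rewrite sqrtr_sqr ger0_norm// ltW// central_ratio_gt0.
Qed.

Section telescope.
Context {R : realType}.
Implicit Types u v G : R^nat.

Lemma cvg_series_telescope u G l : (forall n, u n = G n.+1 - G n) ->
  G @ \oo --> l -> series u @ \oo --> l - G 0%N.
Proof.
move=> uG Gl; rewrite (_ : series u = fun n => G n - G 0%N).
  exact: cvgB Gl (cvg_cst _).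
apply/funext => n; rewrite /series/= -(telescope_sumr _ (leq0n n)).
by apply: eq_bigr => i _; rewrite uG.
Qed.

(* The form in which a Wilf-Zeilberger pair [(u, v), G] is used. *)
Lemma cvg_series_wz u v G a b S : a != 0 -> G 0%N = 0 ->
  (forall n, a * u n - b * v n = G n.+1 - G n) -> G @ \oo --> (0 : R) ->
  series v @ \oo --> S -> series u @ \oo --> b / a * S.
Proof.
move=> a0 G0 uvG Gl vS.
rewrite (_ : series u = fun n => a^-1 * (series (fun n => a * u n - b * v n) n
   + b * series v n)).
  rewrite mulrAC mulrC; apply: cvgM; first exact: cvg_cst.
  rewrite -[b * S]add0r; apply: cvgD; last by apply: cvgM => //; exact: cvg_cst.
  by have := cvg_series_telescope uvG Gl; rewrite G0 subr0.
apply/funext => n; rewrite /series/= sumrB -!mulr_sumr subrK mulKf//.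
Qed.

End telescope.

Section central_ratio_sums.
Context {R : realType}.
Local Notation b := (central_ratio R).

(** Since n b_n^2 <= 1, the sequence is squeezed below [b] itself. It makes the certificates for the
    cubes and for Dixon's series vanish at infinity. *)
Lemma cvg_nat_central_ratio_cube : (fun n => n%:R * b n ^+ 3) @ \oo --> (0 : R).
Proof.
apply: (@squeeze_cvgr _ _ _ _ (cst 0) b); last 2 first.
- exact: cvg_cst.
- exact: cvg_central_ratio.
apply: nearW => n; have b0 := central_ratio_gt0 R n.
rewrite mulr_ge0 ?exprn_ge0 ?(ltW b0)//=.
rewrite exprSr mulrA -[leRHS]mul1r ler_wpM2r ?(ltW b0)//.
apply: le_trans (central_ratio_sqr_le R n).
by rewrite mulrC ler_wpM2l ?sqr_ge0// lerDl.
Qed.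

Lemma is_cvg_series_central_ratio_cube : cvgn (series (fun n => b n ^+ 3)).
Proof.
(* b_n^3 has order n^(-3/2), which is also the order of the decrements of g_n, of order n^(-1/2);
   the factor 4 leaves room for the inequality at every [n]. *)
pose g n : R := (n%:R + 2^-1) * b n ^+ 3.
have bg n : b n ^+ 3 <= 4 * (g n - g n.+1).
  rewrite /g central_ratioS [(b n * _) ^+ 3]exprMn -(natr1 n).
  have : 0 <= n%:R :> R by [].
  have := exprn_ge0 3 (ltW (central_ratio_gt0 R n)).
  set x := n%:R; set y := b n ^+ 3 => y0 x0.
  have x1 : x + 1 != 0 by rewrite gt_eqF// ltr_wpDl.
  rewrite -subr_ge0 (_ : _ - _ =
    y * ((x + 1) ^+ 3 - (x + 1) + 4^-1) / (x + 1) ^+ 3); last first.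
    by field.
  rewrite divr_ge0 ?exprn_ge0 ?addr_ge0// mulr_ge0//; nra.
apply: nondecreasing_is_cvgn.
  by apply: nondecreasing_series => n _ _; rewrite exprn_ge0// ltW ?central_ratio_gt0.
exists (4 * g 0%N) => _ [n _ <-].
apply: (@le_trans _ _ (\sum_(0 <= i < n) 4 * (g i - g i.+1))).
  by apply: ler_sum => i _; exact: bg.
rewrite -mulr_sumr ler_pM2l//.
rewrite (eq_bigr (fun i => - g i.+1 - - g i)); last by move=> i _; rewrite opprK addrC.
rewrite telescope_sumr// opprK addrC lerBlDr lerDl.
by rewrite mulr_ge0// exprn_ge0// ltW// central_ratio_gt0.
Qed.

End central_ratio_sums.

(** * Lower bounds for Pochhammer denominators *)

Section pochhammer.
Context {R : realType}.
Implicit Types (x : R) (n k i : nat).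

Lemma pochhammer0 x : pochhammer x 0 = 1.
Proof. by rewrite /pochhammer big_ord0. Qed.

Lemma pochhammerS x k : pochhammer x k.+1 = pochhammer x k * (x + k%:R).
Proof. by rewrite /pochhammer big_ord_recr. Qed.

Lemma pochhammerSl x k : pochhammer x k.+1 = x * pochhammer (x + 1) k.
Proof.
rewrite /pochhammer big_ord_recl addr0; congr (_ * _); apply: eq_bigr => i _.
by rewrite -addrA nat1r.
Qed.

Lemma pochhammer_nat_ge1 n k : 1 <= pochhammer (n%:R + 1 : R) k.
Proof.
elim: k => [|k IH]; first by rewrite pochhammer0.
rewrite pochhammerS (le_trans IH)// ler_peMr ?(le_trans _ IH)//.
by rewrite addrAC lerDr addr_ge0.
Qed.

(** The number is a half-integer, hence never closer to 0 than 1/2. This keeps the denominators away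
    from 0 although 1/2 - n is negative for n > 0. *)
Lemma half_sub_nat_norm n i : 2^-1 <= `|2^-1 - n%:R + i%:R : R|.
Proof.
have [ni|ni] := leqP n i.
  rewrite -addrA [- _ + _]addrC -natrB// ger0_norm ?addr_ge0//.
  by rewrite lerDl.
have -> : 2^-1 - n%:R + i%:R = 2^-1 - (n - i.+1)%:R - 1 :> R.
  by rewrite natrB// -(natr1 i); ring.
by have := ler0n R (n - i.+1); move=> ?; rewrite ltr0_norm; lra.
Qed.

Lemma half_sub_nat_neq0 n i : 2^-1 - n%:R + i%:R != 0 :> R.
Proof. by rewrite -normr_gt0 (lt_le_trans _ (half_sub_nat_norm n i)). Qed.

Lemma pochhammer_half_norm n k : 2^-1 ^+ k <= `|pochhammer (2^-1 - n%:R : R) k|.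
Proof.
elim: k => [|k IH]; first by rewrite pochhammer0 normr1.
by rewrite pochhammerS normrM exprSr ler_pM// half_sub_nat_norm.
Qed.

Lemma pochhammer_half_neq0 n k : pochhammer (2^-1 - n%:R : R) k != 0.
Proof.
by rewrite -normr_gt0 (lt_le_trans _ (pochhammer_half_norm n k))// exprn_gt0.
Qed.

(** For n > 0 the first factor has size n - 1/2 >= n / 2, and each of the [k] others has size at
    least 1/2. The gain of a factor [n] is what the certificates need. *)
Lemma pochhammer_half_norm_nat n k :
  n%:R <= 2 ^+ k.+1 * `|pochhammer (2^-1 - n%:R : R) k.+1|.
Proof.
case: n => [|n]; first by rewrite mulr_ge0// exprn_ge0.
rewrite pochhammerSl normrM exprS.
have -> : (2^-1 - n.+1%:R + 1 : R) = 2^-1 - n%:R by rewrite -(natr1 n); lra.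
have H := pochhammer_half_norm n k.
have {H} : 1 <= 2 ^+ k * `|pochhammer (2^-1 - n%:R : R) k|.
  by rewrite -ler_pdivrMl ?exprn_gt0// mulr1 -exprVn.
set p := 2 ^+ k; set q := `|pochhammer _ _| => pq.
rewrite mulrACA; apply: (@le_trans _ _ (2 * `|2^-1 - n.+1%:R : R| * 1)).
  rewrite mulr1 ler0_norm -(natr1 n); have := ler0n R n; lra.
by rewrite ler_wpM2l// mulr_ge0.
Qed.

End pochhammer.

(** * The series with Pochhammer denominators *)

Section wz_term.
Context {R : realType}.
Local Notation b := (central_ratio R).
Implicit Types n j k : nat.

Definition wz_term j k n : R :=
  b n ^+ j / (pochhammer (n%:R + 1) k * pochhammer (2^-1 - n%:R) k).

Lemma wz_term0 j n : wz_term j 0 n = b n ^+ j.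
Proof. by rewrite /wz_term !pochhammer0 mulr1 divr1. Qed.

(** Read from [k.+1] down to [k], the relation has a polynomial coefficient, so every term of a
    certificate identity becomes a multiple of [wz_term j k.+1 n]. *)
Lemma wz_termSk j k n :
  wz_term j k n = (n%:R + 1 + k%:R) * (2^-1 - n%:R + k%:R) * wz_term j k.+1 n.
Proof.
have nk : (n%:R + 1 + k%:R : R) != 0 by rewrite gt_eqF// ltr_wpDr// ltr_wpDl.
have hk := half_sub_nat_neq0 n k : _ != 0 :> R.
have p1 : pochhammer (n%:R + 1 : R) k != 0.
  by rewrite gt_eqF// (lt_le_trans _ (pochhammer_nat_ge1 n k)).
have p2 := pochhammer_half_neq0 n k : _ != 0 :> R.
rewrite /wz_term !pochhammerS.
move: (_ + _ + _) (_ + _ + _) (pochhammer _ _) (pochhammer _ _) (b n ^+ j)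
  nk hk p1 p2 => z h p q B nk hk p1 p2.
by field; rewrite p1 p2 nk hk.
Qed.

Lemma wz_termSn j k n :
  wz_term j k n.+1 = - (((n%:R + 2^-1) / (n%:R + 1)) ^+ j * (n%:R + 1) *
    (k%:R - n%:R - 2^-1) / ((n%:R + 1 + k%:R) * (n%:R + 2^-1))) * wz_term j k n.
Proof.
have n1 : (n%:R + 1 : R) != 0 by rewrite gt_eqF// ltr_wpDl.
have nk : (n%:R + 1 + k%:R : R) != 0 by rewrite gt_eqF// ltr_wpDr// ltr_wpDl.
have nh : (n%:R + 2^-1 : R) != 0 by rewrite gt_eqF// ltr_wpDl.
have p1 m : pochhammer (m%:R + 1 : R) k != 0.
  by rewrite gt_eqF// (lt_le_trans _ (pochhammer_nat_ge1 m k)).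
have p2 m := @pochhammer_half_neq0 R m k.
(* The shift in [n] moves the base of both symbols by 1; it is obtained by splitting a product of
   length [k.+1] at its first and at its last factor. *)
have E1 : pochhammer (n.+1%:R + 1) k * (n%:R + 1) =
    pochhammer (n%:R + 1) k * (n%:R + 1 + k%:R) :> R.
  by rewrite -pochhammerS pochhammerSl mulrC -(natr1 n).
have E2 : pochhammer (2^-1 - n.+1%:R) k * (2^-1 - n.+1%:R + k%:R) =
    (2^-1 - n.+1%:R) * pochhammer (2^-1 - n%:R) k :> R.
  rewrite -pochhammerS pochhammerSl; congr (_ * pochhammer _ _).
  by rewrite -(natr1 n); ring.
rewrite /wz_term central_ratioS exprMn.
move: (p1 n) (p1 n.+1) (p2 n) (p2 n.+1) E1 E2.
set u := pochhammer _ k; set u' := pochhammer _ k.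
set v := pochhammer _ k; set v' := pochhammer _ k.
rewrite -(natr1 n) => u0 u0' v0 v0' E1 E2.
have -> : u' = u * (n%:R + 1 + k%:R) / (n%:R + 1) by rewrite -E1 mulfK.
have nh' : (2^-1 - (n%:R + 1) : R) != 0.
  by rewrite (_ : _ - _ = - (n%:R + 2^-1)) ?oppr_eq0//; lra.
have -> : v = v' * (2^-1 - (n%:R + 1) + k%:R) / (2^-1 - (n%:R + 1)).
  by rewrite E2 mulrC mulKf.
have h : (2^-1 - n.+1%:R + k%:R : R) != 0 by exact: half_sub_nat_neq0.
move: nk nh n1 nh' h; rewrite -(natr1 n).
move: (b n ^+ j) (_ ^+ j) => B C.
set x := n%:R; set y := k%:R => nk nh n1 nh' h.
field.
by rewrite u0 v0' n1 nk /=; apply/and3P; split; lra.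
Qed.

(** The factor n + 1 + k cancels the last factor of (n + 1)_(k+1), and [n] is absorbed by
    [pochhammer_half_norm_nat]. The left side is the part common to the certificates of both
    families. *)
Lemma wz_term_norm_le j k n :
  n%:R * (n%:R + 1 + k%:R) * `|wz_term j k.+1 n| <=
  2 ^+ k.+1 * b n ^+ j / pochhammer (n%:R + 1) k.
Proof.
have p1 := pochhammer_nat_ge1 n k : 1 <= _ :> R.
have p0 : 0 < pochhammer (n%:R + 1 : R) k by rewrite (lt_le_trans _ p1).
have nk : 0 < (n%:R + 1 + k%:R : R) by rewrite ltr_wpDr// ltr_wpDl.
have b0 := exprn_ge0 j (ltW (central_ratio_gt0 R n)).
have H : n%:R <= 2 ^+ k.+1 * `|pochhammer (2^-1 - n%:R : R) k.+1|.
  exact: pochhammer_half_norm_nat.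
have q0 : 0 < `|pochhammer (2^-1 - n%:R : R) k.+1|.
  by rewrite normr_gt0 pochhammer_half_neq0.
rewrite /wz_term pochhammerS normrM normfV !normrM (ger0_norm b0).
rewrite (ger0_norm (ltW p0)) (ger0_norm (ltW nk)).
move: H q0; set p := pochhammer _ _ in p1 p0 *; set q := `| _ |.
set z := _ + _ in nk *; set B := b n ^+ j in b0 *; set c := 2 ^+ _; set x := n%:R.
move=> H q0.
rewrite (_ : x * z * _ = x / q * (B / p)); last first.
  by field; rewrite !gt_eqF.
rewrite -[leRHS]mulrA ler_wpM2r ?divr_ge0 ?(ltW p0)//.
by rewrite ler_pdivrMr.
Qed.

Lemma cvg_series_cube_wz k (S : R) :
  series (wz_term 3 k) @ \oo --> S ->
  series (wz_term 3 k.+1) @ \oo -->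
    (k%:R + 4^-1) / ((k%:R + 2^-1) ^+ 2 * (k%:R + 3 / 4)) * S.
Proof.
(* The certificate of the Wilf-Zeilberger pair: after [wz_termSk] and [wz_termSn] its identity is
   one between rational functions of [n] and [k]. *)
pose G n := - 2^-1 * n%:R ^+ 2 * (n%:R + 1 + k%:R) * wz_term 3 k.+1 n.
have k0 : 0 <= k%:R :> R by [].
apply: (@cvg_series_wz _ _ _ G).
- by rewrite mulf_neq0 ?expf_neq0//; lra.
- by rewrite /G expr0n/= mulr0 !mul0r.
- move=> n; rewrite /G (wz_termSk _ k) wz_termSn -(natr1 n) -(natr1 k).
  move: (wz_term _ _ _) => U.
  have x0 : 0 <= n%:R :> R by [].
  set x := n%:R in x0 *; set y := k%:R in k0 *.
  by field; apply/and3P; split; lra.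
- apply: norm_cvg0 => /=.
  (* [wz_term_norm_le] leaves one factor n / 2 of [G], and 2^(k+1) / 2 = 2^k. *)
  apply: (@squeeze_cvgr _ _ _ _ (cst 0) (fun n => 2 ^+ k * (n%:R * b n ^+ 3))).
  + apply: nearW => n; rewrite normr_ge0/= /G.
    have := wz_term_norm_le 3 k n; move: (wz_term 3 k.+1 n) => w.
    have x0 : 0 <= n%:R :> R by [].
    have b0 := exprn_ge0 3 (ltW (central_ratio_gt0 R n)).
    have p1 := pochhammer_nat_ge1 n k : 1 <= _ :> R.
    move=> H.
    rewrite normrM !mulNr normrN [X in X * `|_|]ger0_norm; last first.
      by rewrite !mulr_ge0 ?exprn_ge0// !addr_ge0.
    have {H} : n%:R * (n%:R + 1 + k%:R) * `|w| <= 2 ^+ k.+1 * b n ^+ 3.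
      apply: le_trans H _; rewrite ler_pdivrMr ?(lt_le_trans _ p1)//.
      by rewrite ler_peMr// mulr_ge0// exprn_ge0.
    rewrite exprS; move=> /(ler_wpM2l x0); nra.
  + exact: cvg_cst.
  + rewrite -[0](mulr0 (2 ^+ k)); apply: cvgM; first exact: cvg_cst.
    exact: cvg_nat_central_ratio_cube.
Qed.

(** The recurrence can only start at k = 1: for k = 0 the series of b_n^2 diverges. *)
Lemma cvg_series_sqr_wz k (S : R) : (0 < k)%N ->
  series (wz_term 2 k) @ \oo --> S ->
  series (wz_term 2 k.+1) @ \oo -->
    k%:R / ((k%:R + 4^-1) * (k%:R + 2^-1) * (k%:R + 3 / 4)) * S.
Proof.
move=> kgt0.
pose G n := (8^-1 - n%:R / 2) * n%:R * (n%:R + 1 + k%:R) * wz_term 2 k.+1 n.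
have k0 : 0 <= k%:R :> R by [].
apply: (@cvg_series_wz _ _ _ G).
- by rewrite !mulf_neq0//; lra.
- by rewrite /G !mulr0 !mul0r.
- move=> n; rewrite /G (wz_termSk _ k) wz_termSn -(natr1 n) -(natr1 k).
  move: (wz_term _ _ _) => U.
  have x0 : 0 <= n%:R :> R by [].
  set x := n%:R in x0 *; set y := k%:R in k0 *.
  by field; apply/and3P; split; lra.
- apply: norm_cvg0 => /=.
  apply: (@squeeze_cvgr _ _ _ _ (cst 0) (fun n => 2 ^+ k.+1 * b n)).
  + apply: nearW => n; rewrite normr_ge0/= /G.
    have := wz_term_norm_le 2 k n; move: (wz_term 2 k.+1 n) => w.
    have x0 : 0 <= n%:R :> R by [].
    have b0 := central_ratio_gt0 R n.
    have b1 : b n <= 1.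
      by have := central_ratio_sqr_le R n; nra.
    (* For k > 0 the product (n + 1)_k contains n + 1, which compensates the linear factor 1/8 - n/2
       of [G]. *)
    have p1 : n%:R + 1 <= pochhammer (n%:R + 1 : R) k.
      case: k kgt0 {k0 G} => // k _; rewrite pochhammerSl ler_peMr ?addr_ge0//.
      by rewrite (natr1 n) pochhammer_nat_ge1.
    rewrite !normrM (ger0_norm x0) (@ger0_norm _ (_ + _ + _)) ?addr_ge0// => H.
    have {H} : n%:R * (n%:R + 1 + k%:R) * `|w| <=
        2 ^+ k.+1 * b n ^+ 2 / (n%:R + 1).
      apply: le_trans H _; rewrite ler_wpM2l ?mulr_ge0 ?exprn_ge0 ?sqr_ge0//.
      by rewrite lef_pV2 ?posrE ?ltr_wpDl// (lt_le_trans _ p1)// ltr_wpDl.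
    have N : `|8^-1 - n%:R / 2| <= n%:R + 1 :> R.
      by rewrite ler_norml; apply/andP; split; lra.
    move=> H; rewrite -2!mulrA [n%:R * (_ * _)]mulrA.
    apply: (le_trans (ler_pM (normr_ge0 _) _ N H)); first by rewrite !mulr_ge0// addr_ge0.
    have -> : (n%:R + 1) * (2 ^+ k.+1 * b n ^+ 2 / (n%:R + 1)) =
        2 ^+ k.+1 * b n ^+ 2.
      move: (b n ^+ 2) (2 ^+ _) => B c; field; lra.
    by rewrite ler_wpM2l ?exprn_ge0// expr2 ler_piMl// ltW.
  + exact: cvg_cst.
  + rewrite -[0](mulr0 (2 ^+ k.+1)); apply: cvgM; first exact: cvg_cst.
    exact: cvg_central_ratio.
Qed.

(** For k = 1 the term is itself a difference of [G]. Only the part 16/3 n b_n^2 of [G] survives in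
    the limit, so the sum is reduced to Wallis' constant, here [c]. *)
Lemma cvg_series_sqr_wz1 (c : R) :
  (fun n => n%:R * b n ^+ 2) @ \oo --> c ->
  series (wz_term 2 1) @ \oo --> 16 / 3 * c.
Proof.
move=> bc.
pose G n := 16 / 3 * (n%:R * b n ^+ 2) + 4 / 3 * (n%:R / (n%:R - 2^-1) * b n ^+ 2).
rewrite -[_ * c]subr0 -[X in _ - X](_ : G 0%N = 0); last first.
  by rewrite /G !mul0r !mulr0 addr0.
apply: cvg_series_telescope.
  move=> n; rewrite /G /wz_term /pochhammer !big_ord1 !addr0 central_ratioS.
  rewrite [(b n * _) ^+ 2]exprMn -(natr1 n).
  have x0 : 0 <= n%:R :> R by [].
  have h : (2^-1 - n%:R + 0%:R : R) != 0 by exact: half_sub_nat_neq0.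
  move: h; rewrite addr0 => h.
  move: (b n ^+ 2) => B; set x := n%:R in h x0 *.
  by field; apply/and3P; split; lra.
rewrite -[_ * c]addr0; apply: cvgD; first by apply: cvgM => //; exact: cvg_cst.
rewrite -[0](mulr0 (4 / 3)); apply: cvgM; first exact: cvg_cst.
apply: norm_cvg0 => /=.
apply: (@squeeze_cvgr _ _ _ _ (cst 0) (fun n => 2 * b n)).
- apply: nearW => n; rewrite normr_ge0/=.
  have b0 := central_ratio_gt0 R n.
  have x0 : 0 <= n%:R :> R by [].
  have b1 : b n <= 1 by have := central_ratio_sqr_le R n; nra.
  have bb : b n ^+ 2 <= b n by rewrite expr2 ler_piMl// ltW.
  rewrite normrM [X in _ * X]ger0_norm ?sqr_ge0// ler_pM ?sqr_ge0//.
  (* The case of a single factor says n <= 2 |1/2 - n|, so the quotient n / (n - 1/2) is bounded by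
     2. *)
  have : n%:R <= 2 ^+ 1 * `|pochhammer (2^-1 - n%:R : R) 1|.
    exact: pochhammer_half_norm_nat.
  rewrite /pochhammer big_ord1 addr0 expr1 distrC normrM normfV.
  have h : 2^-1 - n%:R + 0%:R != 0 :> R by exact: half_sub_nat_neq0.
  rewrite (ger0_norm x0) ler_pdivrMr// normr_gt0.
  by move: h; rewrite addr0 -oppr_eq0 opprB.
- exact: cvg_cst.
- rewrite -[0](mulr0 2); apply: cvgM; first exact: cvg_cst.
  exact: cvg_central_ratio.
Qed.

End wz_term.

(** * Dixon's series *)

Section dixon.
Context {R : realType}.
Local Notation b := (central_ratio R).
Implicit Types (a : R) (n m : nat).

(** The ratio of consecutive terms of the well-poised series 3F2(a, 1/2, 1/2; a + 1/2, a + 1/2;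
    1). *)
Definition dixon_ratio a n : R :=
  (a + n%:R) * (n%:R + 2^-1) ^+ 2 / ((n%:R + 1) * (a + n%:R + 2^-1) ^+ 2).

Definition dixon_term a n : R := \prod_(i < n) dixon_ratio a i.

Lemma dixon_termS a n : dixon_term a n.+1 = dixon_term a n * dixon_ratio a n.
Proof. by rewrite /dixon_term big_ord_recr. Qed.

Lemma dixon_term0 a : dixon_term a 0 = 1.
Proof. by rewrite /dixon_term big_ord0. Qed.

Lemma dixon_ratio_ge0 a n : 0 <= a -> 0 <= dixon_ratio a n.
Proof.
move=> a0; rewrite /dixon_ratio divr_ge0 ?mulr_ge0 ?addr_ge0 ?sqr_ge0//.
Qed.

Lemma dixon_term_ge0 a n : 0 <= a -> 0 <= dixon_term a n.
Proof. by move=> a0; apply: prodr_ge0 => i _; exact: dixon_ratio_ge0. Qed.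

Lemma dixon_ratio_half n :
  dixon_ratio 2^-1 n = ((n%:R + 2^-1) / (n%:R + 1)) ^+ 3.
Proof.
have x0 : 0 <= n%:R :> R by [].
by rewrite /dixon_ratio; field; apply/andP; split; lra.
Qed.

Lemma dixon_term_half n : dixon_term 2^-1 n = b n ^+ 3.
Proof.
elim: n => [|n IH]; first by rewrite dixon_term0 central_ratio0 expr1n.
by rewrite dixon_termS IH central_ratioS [RHS]exprMn dixon_ratio_half.
Qed.

(** The difference has the factor a - 1/2, and the cofactor is nonnegative because (x + 1/2)(a + x)
    >= 1/4. Hence the cubes of [b] dominate all the series with a >= 1/2. *)
Lemma dixon_ratio_le a n : 2^-1 <= a -> dixon_ratio a n <= dixon_ratio 2^-1 n.
Proof.
have x0 : 0 <= n%:R :> R by [].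
rewrite /dixon_ratio; move: n%:R x0 => x x0 a0.
have a1 : 0 < a + x + 2^-1 by lra.
have a2 : 0 < 2^-1 + x + 2^-1 by lra.
rewrite ler_pdivrMr ?mulr_gt0 ?exprn_gt0//; last lra.
rewrite -subr_ge0 (_ : _ - _ = (x + 2^-1) ^+ 2 * (a - 2^-1) *
  ((x + 2^-1) * (a + x) - 4^-1) / (x + 1) ^+ 2); last first.
  by field; apply/andP; split; lra.
rewrite divr_ge0 ?sqr_ge0// !mulr_ge0 ?sqr_ge0//; nra.
Qed.

Lemma dixon_term_le a n : 2^-1 <= a -> dixon_term a n <= b n ^+ 3.
Proof.
move=> a0; rewrite -dixon_term_half; apply: ler_prod => i _.
by rewrite dixon_ratio_ge0 ?dixon_ratio_le//; lra.
Qed.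

(** Only the first ratio is sharpened: a / (4 (a + 1/2)^2) <= 1 / (4 a), which is 2 / a times its
    value 1/8 at a = 1/2. The factor 1 / a makes the tail vanish as [a] grows. *)
Lemma dixon_termS_le a n : 2^-1 <= a ->
  dixon_term a n.+1 <= 2 / a * b n.+1 ^+ 3.
Proof.
move=> a0; rewrite -dixon_term_half /dixon_term !big_ord_recl mulrA.
apply: ler_pM.
- by rewrite dixon_ratio_ge0//; lra.
- by apply: prodr_ge0 => i _; rewrite dixon_ratio_ge0//; lra.
- rewrite /dixon_ratio !addr0 !add0r -subr_ge0 (_ : _ - _ =
    ((a + 2^-1) ^+ 2 - a ^+ 2) / (4 * a * (a + 2^-1) ^+ 2)); last first.
    by field; apply/andP; split; lra.
  by rewrite divr_ge0 ?mulr_ge0 ?sqr_ge0//; nra.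
- apply: ler_prod => i _.
  by rewrite dixon_ratio_ge0 ?dixon_ratio_le//; lra.
Qed.

(** Shifting the base of a Pochhammer symbol by 2 changes only two factors at each end, so the terms
    at [a] and a + 2 differ by a rational function of [n]. *)
Lemma dixon_termD2 a n : 0 < a ->
  dixon_term (a + 2) n = dixon_term a n *
    ((a + 2^-1) ^+ 2 * (a + 3 / 2) ^+ 2 * (a + n%:R) * (a + n%:R + 1) /
    (a * (a + 1) * (a + n%:R + 2^-1) ^+ 2 * (a + n%:R + 3 / 2) ^+ 2)).
Proof.
move=> a0; elim: n => [|n IH].
  rewrite !dixon_term0 addr0; field; do ?[apply/andP; split]; lra.
rewrite !dixon_termS IH /dixon_ratio -(natr1 n); have x0 : 0 <= n%:R :> R by [].
move: (dixon_term _ _) n%:R x0 => t x x0.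
by field; do ?[apply/andP; split]; lra.
Qed.

(** The quotient of Dixon's closed form at a + 2 and at [a]. The step is 2 because that form
    contains Gamma at a / 2, so that a step of 2 gives a rational quotient. *)
Definition dixon_factor a : R :=
  (a + 2^-1) ^+ 2 * (a + 3 / 2) ^+ 2 / (a + 1) ^+ 4.

Lemma cvg_series_dixonD2 a (S : R) : 2^-1 <= a ->
  series (dixon_term a) @ \oo --> S ->
  series (dixon_term (a + 2)) @ \oo --> dixon_factor a * S.
Proof.
move=> ah; have a0 : 0 < a by lra.
pose P := (a + 2^-1) ^+ 2 * (a + 3 / 2) ^+ 2.
(* The quadratic numerator of the certificate; for a >= 1/2 it lies between 0 and 2 (a + n + 1/2)^2,
   so [G] is dominated by a multiple of n b_n^3. *)
pose X n : R := n%:R ^+ 2 + (3 * a + 1) * n%:R + 2 * a ^+ 2 + a - 4^-1.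
pose G n := P / a * (X n / (a + n%:R + 2^-1) ^+ 2) * (n%:R * dixon_term a n).
have P0 : 0 <= P by rewrite mulr_ge0 ?sqr_ge0.
apply: (@cvg_series_wz _ _ _ G); first by rewrite expf_neq0//; lra.
- by rewrite /G !mul0r mulr0.
- move=> n; rewrite /G /X /P dixon_termD2// dixon_termS /dixon_ratio -(natr1 n).
  have x0 : 0 <= n%:R :> R by [].
  move: (dixon_term _ _) n%:R x0 => t x x0.
  by field; do ?[apply/andP; split]; lra.
- apply: (@squeeze_cvgr _ _ _ _ (cst 0) (fun n => P / a * 2 * (n%:R * b n ^+ 3))).
  + apply: nearW => n; rewrite /G.
    have x0 : 0 <= n%:R :> R by [].
    have X0 : 0 <= X n by rewrite /X; nra.
    have Q0 : 0 <= P / a by rewrite divr_ge0// ltW.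
    have A0 : 0 < a + n%:R + 2^-1 by lra.
    have Y0 : 0 <= X n / (a + n%:R + 2^-1) ^+ 2 by rewrite divr_ge0// sqr_ge0.
    have Y2 : X n / (a + n%:R + 2^-1) ^+ 2 <= 2.
      by rewrite ler_pdivrMr ?exprn_gt0// /X; nra.
    have t0 := dixon_term_ge0 n (ltW a0); have tb := dixon_term_le n ah.
    apply/andP; split; first by apply: mulr_ge0; apply: mulr_ge0.
    apply: ler_pM; [exact: mulr_ge0 | exact: mulr_ge0 | |].
    - by rewrite ler_wpM2l.
    - by rewrite ler_wpM2l.
  + exact: cvg_cst.
  + rewrite -[0](mulr0 (P / a * 2)); apply: cvgM; first exact: cvg_cst.
    exact: cvg_nat_central_ratio_cube.
Qed.

(** The term at 0 is 1 and [dixon_termS_le] bounds the others, so the sum tends to 1 as [a] tends to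
    infinity. *)
Lemma series_dixon_bounds a (S D : R) : 2^-1 <= a ->
  series (fun n => b n ^+ 3) @ \oo --> S ->
  series (dixon_term a) @ \oo --> D -> 1 <= D <= 1 + 2 / a * S.
Proof.
move=> ah bS tD; have a0 : 0 < a by lra.
have E n (u : R^nat) : series u n.+1 = u 0%N + \sum_(0 <= i < n) u i.+1.
  by rewrite /series/= big_nat_recl.
apply/andP; split.
  apply: (cvgr_to_ge tD); exists 1%N => // -[//|n] _ /=.
  rewrite E dixon_term0 lerDl sumr_ge0// => i _.
  by rewrite dixon_term_ge0// ltW.
have bnd : (fun n => 1 + 2 / a * series (fun n => b n ^+ 3) n) @ \oo --> 1 + 2 / a * S.
  by apply: cvgD; [exact: cvg_cst | apply: cvgM => //; exact: cvg_cst].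
apply: (ler_cvg_to tD bnd); exists 1%N => // -[//|n] _ /=.
rewrite !E dixon_term0 lerD2l mulrDr mulr_sumr.
rewrite ler_wpDl ?mulr_ge0 ?exprn_ge0 ?invr_ge0 ?(ltW a0) ?(ltW (central_ratio_gt0 R 0))//.
by apply: ler_sum => i _; exact: dixon_termS_le.
Qed.

(* Dixon's summation of the series of [dixon_term a], in the form obtained by
   iterating [a -> a + 2], which makes all terms but the first one vanish. *)
Lemma cvg_dixon_prod (S : R) : series (fun n => b n ^+ 3) @ \oo --> S ->
  (fun m => S * \prod_(j < m) dixon_factor (2^-1 + 2 * j%:R)) @ \oo --> (1 : R).
Proof.
move=> bS.
have D m : series (dixon_term (2^-1 + 2 * m%:R)) @ \oo -->
    S * \prod_(j < m) dixon_factor (2^-1 + 2 * j%:R).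
  elim: m => [|m IH].
    rewrite mulr0 addr0 big_ord0 mulr1.
    by rewrite (_ : dixon_term _ = fun n => b n ^+ 3)//; apply/funext => n;
       exact: dixon_term_half.
  rewrite big_ord_recr/= mulrA [X in _ --> X]mulrC.
  have -> : 2^-1 + 2 * m.+1%:R = 2^-1 + 2 * m%:R + 2 :> R.
    by rewrite -(natr1 m); ring.
  apply: cvg_series_dixonD2 => //.
  by rewrite lerDl mulr_ge0.
have S0 : 0 <= S.
  apply: (cvgr_to_ge bS); apply: nearW => n.
  by rewrite sumr_ge0// => i _; rewrite exprn_ge0// ltW// central_ratio_gt0.
apply: (@squeeze_cvgr _ _ _ _ (cst 1) (fun m => 1 + 4 * S * harmonic m)).
- apply: nearW => m.
  have am : 2^-1 <= 2^-1 + 2 * m%:R :> R by rewrite lerDl mulr_ge0.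
  have /andP[-> H]/= := series_dixon_bounds am bS (D m).
  apply: le_trans H _; rewrite lerD2l /harmonic -(natr1 m).
  have m0 : 0 <= m%:R :> R by [].
  rewrite [leRHS]mulrAC ler_wpM2r// ler_pdivrMr; last lra.
  by rewrite mulrAC ler_pdivlMr; lra.
- exact: cvg_cst.
- rewrite -[X in _ --> X]addr0; apply: cvgD; first exact: cvg_cst.
  rewrite -[0](mulr0 (4 * S)); apply: cvgM; first exact: cvg_cst.
  exact: cvg_harmonic.
Qed.

End dixon.

(** * The Gamma function *)

Section gamma_integral.
Context {R : realType}.
Local Notation mu := (@lebesgue_measure R).
Implicit Types (x y : R) (n p : nat) (f : R -> R).

(** Compact intervals on which integration by parts and substitution apply. The exponent [p] is
    there for the substitution t = s^2, which maps the interval for p = 1 onto the one for p = 2. *)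
Definition exhausting_itv p n : set R := `[(n.+1%:R ^+ p)^-1, n.+1%:R ^+ p]%classic.

Lemma exhausting_itv_gt0 p n t : exhausting_itv p n t -> 0 < t.
Proof.
by rewrite /exhausting_itv/= in_itv/= => /andP[+ _]; apply: lt_le_trans;
  rewrite invr_gt0 exprn_gt0.
Qed.

Lemma bigcup_exhausting_itv p : (0 < p)%N ->
  \bigcup_n exhausting_itv p n = `]0, +oo[%classic.
Proof.
move=> p0; apply/seteqP; split => [t [n _ /exhausting_itv_gt0 t0]|t].
  by rewrite /= in_itv/= t0.
rewrite /= in_itv/= andbT => t0.
(* The successor of this index exceeds both [t] and its inverse. *)
exists (Num.truncn (t + t^-1)) => //.
rewrite /exhausting_itv /= in_itv/=.
have ti0 : 0 < t^-1 by rewrite invr_gt0.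
have : t + t^-1 <= (Num.truncn (t + t^-1)).+1%:R ^+ p.
  have H : t + t^-1 <= (Num.truncn (t + t^-1)).+1%:R.
    by rewrite ltW// truncnS_gt.
  apply: (le_trans H); rewrite -(prednK p0) exprS ler_peMr//.
  by rewrite exprn_ege1// ler1n.
set N := _ ^+ p => H.
have N0 : 0 < N by rewrite exprn_gt0.
apply/andP; split; last lra.
rewrite -(invrK t) lef_pV2 ?posrE//; lra.
Qed.

Lemma nondecreasing_exhausting_itv p : nondecreasing_seq (exhausting_itv p).
Proof.
apply/nondecreasing_seqP => n; rewrite subsetEset.
have H : n.+1%:R ^+ p <= n.+2%:R ^+ p :> R.
  by rewrite lerXn2r ?nnegrE// ler_nat.
apply: subset_itvScc; rewrite bnd_simp//.
by rewrite lef_pV2 // posrE exprn_gt0.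
Qed.

Lemma cvg_integral_exhausting_itv p f : (0 < p)%N ->
  measurable_fun setT f -> (forall t, 0 < t -> 0 <= f t) ->
  (\int[mu]_(t in exhausting_itv p n) (f t)%:E)%E @[n --> \oo] -->
  (\int[mu]_(t in `]0%R, +oo[) (f t)%:E)%E.
Proof.
move=> p0 mf f0; rewrite -(bigcup_exhausting_itv p0).
apply: ge0_nondecreasing_set_cvg_integral.
- exact: nondecreasing_exhausting_itv.
- by move=> i; exact: measurable_itv.
- by move=> i; apply/measurable_EFinP; exact: measurable_funTS.
- by move=> i t /exhausting_itv_gt0 t0; rewrite lee_fin f0.
Qed.

Definition gamma_fun x t := t `^ (x - 1) * expR (- t).

Lemma gamma_fun_ge0 x t : 0 <= gamma_fun x t.
Proof. by rewrite mulr_ge0 ?powR_ge0 ?expR_ge0. Qed.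

Lemma measurable_gamma_fun x : measurable_fun setT (gamma_fun x).
Proof.
apply: measurable_funM; first exact: measurable_powR.
by apply: measurableT_comp => //; exact: measurableT_comp.
Qed.

(** Euler's integral before [fine], which would send an infinite value to 0. The recurrence is
    proved at this level and then yields finiteness. *)
Definition gamma_ereal x : \bar R := (\int[mu]_(t in `]0%R, +oo[) (gamma_fun x t)%:E)%E.

Lemma GammaE x : Gamma x = fine (gamma_ereal x).
Proof. by []. Qed.

Lemma gamma_ereal_ge0 x : (0 <= gamma_ereal x)%E.
Proof. by apply: integral_ge0 => t _; rewrite lee_fin gamma_fun_ge0. Qed.

Lemma cvg_powR_expRN x : 0 < x ->
  (fun n : nat => n.+1%:R `^ x * expR (- n.+1%:R)) @ \oo --> (0 : R).
Proof.
move=> x0; pose m := Num.truncn x.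
apply: (@squeeze_cvgr _ _ _ _ (cst 0) (fun n => m.+2`!%:R * harmonic n)).
- apply: nearW => n; rewrite mulr_ge0 ?powR_ge0 ?expR_ge0//=.
  have n1 : 1 <= n.+1%:R :> R by rewrite ler1n.
  apply: (@le_trans _ _ (n.+1%:R ^+ m.+1 * expR (- n.+1%:R))).
    rewrite ler_wpM2r ?expR_ge0// -powR_mulrn// ler_powR//.
    by rewrite ltW// truncnS_gt.
  (* The exponential dominates its Taylor term of degree m + 2, one more than the power m + 1 that
     bounds the real power; the spare degree gives 1 / (n + 1). *)
  have := @expR_ge1Dxn R n.+1%:R m.+1 (ler0n _ _).
  rewrite expRN /harmonic -[n.+1%:R in X in _ -> _ <= X]/(n.+1%:R : R).
  set y := n.+1%:R in n1 *; set e := expR y; set F := _`!%:R => H.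
  have y0 : 0 < y by lra.
  have F0 : 0 < F by rewrite /F ltr0n fact_gt0.
  have e0 : 0 < e by exact: expR_gt0.
  rewrite ler_pdivrMr// mulrAC ler_pdivlMr// -exprSr.
  rewrite mulrC -ler_pdivrMr//; lra.
- exact: cvg_cst.
- rewrite -[0](mulr0 (m.+2`!%:R)); apply: cvgM; first exact: cvg_cst.
  exact: cvg_harmonic.
Qed.

Lemma cvg_powR_inv x : 0 < x ->
  (fun n : nat => n.+1%:R^-1 `^ x) @ \oo --> (0 : R).
Proof.
move=> x0; have /cvg_at_rightP := powR_cvg0 x0.
by apply; split => [n|]; [rewrite invr_gt0 | exact: cvg_harmonic].
Qed.

Lemma continuous_powR x t : 0 < t -> {for t, continuous (fun t => t `^ x)}.
Proof.
move=> t0; apply: differentiable_continuous; apply/derivable1_diffP.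
by apply: derivable_powR; rewrite in_itv/= t0.
Qed.

Lemma continuous_gamma_fun x t : 0 < t -> {for t, continuous (gamma_fun x)}.
Proof.
move=> t0; apply: cvgM; first exact: continuous_powR.
apply: continuous_comp; first exact: opp_continuous.
exact: continuous_expR.
Qed.

(** Integration by parts against - exp (- t). The index is [n.+1] because the interval of index 0 is
    a single point, while the endpoints have to be distinct. *)
Lemma integral_gamma_fun_parts x n : 0 < x ->
  (\int[mu]_(t in exhausting_itv 1 n.+1) (gamma_fun (x + 1) t)%:E =
   (n.+2%:R^-1 `^ x * expR (- n.+2%:R^-1) - n.+2%:R `^ x * expR (- n.+2%:R))%:E +
   x%:E * \int[mu]_(t in exhausting_itv 1 n.+1) (gamma_fun x t)%:E)%E.
Proof.
move=> x0; rewrite /exhausting_itv expr1.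
pose a : R := n.+2%:R^-1; rewrite -/a; set c : R := n.+2%:R.
have a0 : 0 < a by rewrite invr_gt0.
have ac : a < c.
  by rewrite (@lt_trans _ _ 1)// ?invf_lt1 ?ltr1n.
have pos t : t \in `]a, c[ -> 0 < t.
  by rewrite in_itv/= => /andP[+ _]; exact: lt_trans.
have wi f : (forall t : R, 0 < t -> {for t, continuous f}) -> {within `[a, c], continuous f}.
  move=> cf; apply: continuous_in_subspaceT => t; rewrite inE/= in_itv/= => /andP[at_ _].
  by apply: cf; exact: lt_le_trans at_.
have dbnd f : (forall t : R, 0 < t -> derivable f t 1) -> derivable_oo_LRcontinuous f a c.
  move=> df; have cf (t : R) : 0 < t -> {for t, continuous f}.
    by move=> t0; apply: differentiable_continuous; apply/derivable1_diffP; exact: df.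
  split.
  - by move=> t /pos; exact: df.
  - by apply: cvg_at_right_filter; exact: cf.
  - by apply: cvg_at_left_filter; apply: cf; exact: lt_trans ac.
have dE (t : R) : is_derive t 1 (fun t : R => - expR (- t)) (expR (- t)).
  apply: is_derive_eq; rewrite /GRing.scale/=; ring.
rewrite (_ : (fun t => (gamma_fun (x + 1) t)%:E) = (fun t => (t `^ x * expR (- t))%:E));
  last by apply/funext => t; rewrite /gamma_fun addrK.
rewrite (@integration_by_parts _ (fun t => t `^ x) (fun t => - expR (- t))
  (fun t => x * t `^ (x - 1)) (fun t => expR (- t)) a c ac).
- congr (_ + _)%E.
    by congr EFin; rewrite !mulrN opprK addrC.
  rewrite -ge0_integralZl_EFin//; last 3 first.
  + by move=> t _; rewrite lee_fin gamma_fun_ge0.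
  + by apply/measurable_EFinP; apply: measurable_funTS; exact: measurable_gamma_fun.
  + exact: ltW.
  have -> : (fun t => (x * t `^ (x - 1) * - expR (- t))%:E) =
      (fun t => - (x%:E * (gamma_fun x t)%:E))%E.
    by apply/funext => t; rewrite -EFinM -EFinN /gamma_fun mulrN mulrA.
  rewrite integral_ge0N ?oppeK// => t _.
  by rewrite mule_ge0// lee_fin ?gamma_fun_ge0// ltW.
- apply: wi => t t0; apply: cvgM; [exact: cvg_cst | exact: continuous_powR].
- by apply: dbnd => t t0; apply: derivable_powR; rewrite in_itv/= t0.
- by move=> t /pos t0; rewrite powR_derive1// in_itv/= t0.
- apply: wi => t t0; apply: continuous_comp; [exact: opp_continuous |].
  exact: continuous_expR.
- by apply: dbnd => t t0; exact: (@ex_derive _ _ _ _ _ _ _ (dE t)).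
- by move=> t _; rewrite derive1E; exact: (@derive_val _ _ _ _ _ _ _ (dE t)).
Qed.

(** Both boundary terms t^x exp (- t) vanish in the limit, the one at 0 because x > 0. *)
Lemma gamma_ereal_rec x : 0 < x -> (gamma_ereal (x + 1) = x%:E * gamma_ereal x)%E.
Proof.
move=> x0.
have cvg y := @cvg_integral_exhausting_itv 1 _ isT (measurable_gamma_fun y)
  (fun t _ => gamma_fun_ge0 y t).
rewrite [LHS]/gamma_ereal -(cvg_lim _ (cvg (x + 1)))//.
apply/cvg_lim => //; rewrite -cvg_shiftS/=.
under eq_fun do rewrite integral_gamma_fun_parts//.
rewrite -[(x%:E * _)%E]add0e; apply: cvgeD => //.
- apply: cvg_EFin; first exact: nearW.
  rewrite -[0](subr0 (0 : R)); apply: cvgB; last first.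
    by have := cvg_powR_expRN x0; rewrite -cvg_shiftS.
  rewrite -(mul0r (expR (- 0))); apply: cvgM.
    by have := cvg_powR_inv x0; rewrite -cvg_shiftS.
  apply: continuous_cvg; first exact: continuous_expR.
  apply: cvgN; have := @cvg_harmonic R; rewrite -cvg_shiftS; exact.
- apply: cvgeZl => //.
  by have := cvg x; rewrite -cvg_shiftS.
Qed.

Lemma gamma_ereal1 : gamma_ereal 1 = 1%E.
Proof.
rewrite /gamma_ereal integral_itv_obnd_cbnd; last first.
  by apply/measurable_EFinP; apply: measurable_funTS; exact: measurable_gamma_fun.
have dE (t : R) : is_derive t 1 (fun t : R => - expR (- t)) (expR (- t)).
  apply: is_derive_eq; rewrite /GRing.scale/=; ring.
have -> : gamma_fun 1 = (fun t => expR (- t)).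
  by apply/funext => t; rewrite /gamma_fun subrr powRr0 mul1r.
have cE : continuous (fun t : R => expR (- t)).
  by move=> t; apply: continuous_comp; [exact: opp_continuous | exact: continuous_expR].
rewrite (@ge0_continuous_FTC2y _ _ (fun t => - expR (- t)) _ 0).
- by rewrite oppr0 expR0 -EFinB opprK add0r.
- by move=> t _; exact: expR_ge0.
- exact: continuous_subspaceT.
- rewrite -oppr0; apply: cvgN; exact: cvgr_expR.
- by move=> t _; exact: (@ex_derive _ _ _ _ _ _ _ (dE t)).
- apply: cvg_at_right_filter; apply: cvgN; exact: cE.
- by move=> t _; rewrite derive1E; exact: (@derive_val _ _ _ _ _ _ _ (dE t)).
Qed.


End gamma_integral.

Section gamma.
Context {R : realType}.
Local Notation mu := (@lebesgue_measure R).
Implicit Types (x y : R) (n : nat).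

Lemma gamma_ereal_nat n : gamma_ereal n.+1%:R \is a (@fin_num R).
Proof.
elim: n => [|n IH]; first by rewrite gamma_ereal1.
by rewrite -natr1 gamma_ereal_rec// fin_numM.
Qed.

Lemma integrable_gamma_fun x : gamma_ereal x \is a fin_num ->
  mu.-integrable `]0, +oo[ (EFin \o gamma_fun x).
Proof.
move=> xfin; apply/integrableP; split.
  by apply/measurable_EFinP; apply: measurable_funTS; exact: measurable_gamma_fun.
have -> : (fun t => `|(EFin \o gamma_fun x) t|)%E = EFin \o gamma_fun x.
  by apply/funext => t; rewrite /= ger0_norm// gamma_fun_ge0.
by rewrite -ge0_fin_numE ?gamma_ereal_ge0.
Qed.

(** For y >= 1 the integrand is below the sum of those at 1 and at an integer n + 1 >= y, which have
    finite integrals; the recurrence covers 0 < x < 1. *)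
Lemma gamma_ereal_fin x : 0 < x -> gamma_ereal x \is a fin_num.
Proof.
have ge1 y : 1 <= y -> gamma_ereal y \is a fin_num.
  move=> y1; pose n := Num.truncn y.
  have yn : y <= n.+1%:R by rewrite ltW// truncnS_gt.
  rewrite ge0_fin_numE ?gamma_ereal_ge0//.
  apply: (@le_lt_trans _ _ (gamma_ereal 1 + gamma_ereal n.+1%:R)%E); last first.
    by rewrite gamma_ereal1 lte_add_pinfty// ?ltry// -ge0_fin_numE ?gamma_ereal_ge0//
      gamma_ereal_nat.
  rewrite /gamma_ereal -ge0_integralD//; last 4 first.
  - by move=> t _; rewrite lee_fin gamma_fun_ge0.
  - by apply/measurable_EFinP; apply: measurable_funTS; exact: measurable_gamma_fun.
  - by move=> t _; rewrite lee_fin gamma_fun_ge0.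
  - by apply/measurable_EFinP; apply: measurable_funTS; exact: measurable_gamma_fun.
  apply: ge0_le_integral => //.
  - by move=> t _; rewrite lee_fin gamma_fun_ge0.
  - by apply/measurable_EFinP; apply: measurable_funTS; exact: measurable_gamma_fun.
  - by apply: emeasurable_funD; apply/measurable_EFinP; apply: measurable_funTS;
       exact: measurable_gamma_fun.
  move=> t; rewrite /= in_itv/= andbT => t0.
  rewrite -EFinD lee_fin /gamma_fun -mulrDl ler_wpM2r ?expR_ge0//.
  rewrite subrr powRr0; have [t1|t1] := leP t 1.
    apply: (@le_trans _ _ (t `^ 0)); last by rewrite powRr0 lerDl powR_ge0.
    by apply: ger_powR; rewrite ?t0// subr_ge0.
  apply: ler_wpDl => //; apply: ler_powR; first exact: ltW.
  by rewrite lerB.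
move=> x0.
have -> : gamma_ereal x = ((x^-1)%:E * gamma_ereal (x + 1))%E.
  by rewrite gamma_ereal_rec// muleA -EFinM mulVf ?gt_eqF// mul1e.
by rewrite fin_numM// ge1// lerDr ltW.
Qed.

Lemma Gamma_rec x : 0 < x -> Gamma (x + 1) = x * Gamma x.
Proof.
by move=> x0; rewrite !GammaE gamma_ereal_rec// fineM// gamma_ereal_fin.
Qed.

Lemma Gamma1 : Gamma 1 = 1 :> R.
Proof. by rewrite GammaE gamma_ereal1. Qed.

Lemma Gamma_nat n : Gamma n.+1%:R = n`!%:R :> R.
Proof.
elim: n => [|n IH]; first by rewrite Gamma1 fact0.
by rewrite -natr1 Gamma_rec// IH factS natrM.
Qed.

(** Pointwise 2 u v <= c u^2 + v^2 / c, integrated. With [c] free this replaces the Cauchy-Schwarz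
    inequality. *)
Lemma Gamma_amgm x y (c : R) : 0 < x -> 0 < y -> 0 < c ->
  2 * Gamma ((x + y) / 2) <= c * Gamma x + c^-1 * Gamma y.
Proof.
move=> x0 y0 c0; have m0 : 0 < (x + y) / 2 by rewrite divr_gt0// addr_gt0.
have ix := integrable_gamma_fun (gamma_ereal_fin x0).
have iy := integrable_gamma_fun (gamma_ereal_fin y0).
have im := integrable_gamma_fun (gamma_ereal_fin m0).
have iZ z r : mu.-integrable `]0, +oo[ (EFin \o gamma_fun z) ->
    mu.-integrable `]0, +oo[ (EFin \o (fun t => r * gamma_fun z t)).
  by move=> iz; exact: (integrableZl _ r iz).
rewrite /Gamma -!RintegralZl// -RintegralD//; [|exact: iZ|exact: iZ].

apply: le_Rintegral => //.
- exact: iZ.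
- exact: (integrableD _ (iZ _ c ix) (iZ _ c^-1 iy)).
-   move=> t; rewrite /= in_itv/= andbT => t0.
  rewrite !mulrA -mulrDl ler_wpM2r ?expR_ge0//.
  have tD r s : t `^ (r + s) = t `^ r * t `^ s.
    by rewrite powRD// (gt_eqF t0) implybT.
  pose u := t `^ ((x - 1) / 2); pose v := t `^ ((y - 1) / 2).
  have -> : t `^ (x - 1) = u ^+ 2 by rewrite expr2 -tD -splitr.
  have -> : t `^ (y - 1) = v ^+ 2 by rewrite expr2 -tD -splitr.
  have -> : t `^ ((x + y) / 2 - 1) = u * v.
    by rewrite -tD; congr (_ `^ _); lra.
  rewrite -subr_ge0 (_ : _ - _ = (c * u - v) ^+ 2 / c); last by field; rewrite gt_eqF.
  by rewrite divr_ge0 ?sqr_ge0// ltW.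
Qed.

Lemma Gamma_ge0 x : 0 <= Gamma x.
Proof. by rewrite GammaE fine_ge0// gamma_ereal_ge0. Qed.

(** If Gamma vanished at x <= 1, then [Gamma_amgm] for [x] and 2 - x, whose midpoint is 1, would
    bound 2 by Gamma (2 - x) / c with [c] as large as desired. The recurrence reaches larger [x]. *)
Lemma Gamma_gt0 x : 0 < x -> 0 < Gamma x.
Proof.
have [n] : exists n, x <= n.+1%:R.
  by exists (Num.truncn x); rewrite ltW// truncnS_gt.
elim: n x => [|n IH] x xn x0.
  rewrite lt_neqAle Gamma_ge0 andbT eq_sym; apply/negP => /eqP Gx.
  have y0 : 0 < 2 - x by lra.
  have c0 : 0 < Gamma (2 - x) + 1 by rewrite ltr_wpDl// Gamma_ge0.
  have := Gamma_amgm x0 y0 c0; rewrite Gx mulr0 add0r mulrC.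
  rewrite (_ : (x + (2 - x)) / 2 = 1); last by lra.
  rewrite Gamma1 mul1r ler_pdivlMl//; have := Gamma_ge0 (2 - x); lra.
have [x1|x1] := leP x 1; first by apply: IH; rewrite ?(le_trans x1)// ler1n.
have x1' : 0 < x - 1 by lra.
by rewrite -(subrK 1 x) Gamma_rec// mulr_gt0// IH// lerBlDr natr1.
Qed.

Lemma Gamma_midpoint x y : 0 < x -> 0 < y ->
  Gamma ((x + y) / 2) ^+ 2 <= Gamma x * Gamma y.
Proof.
move=> x0 y0; have Gx := Gamma_gt0 x0; have Gy := Gamma_gt0 y0.
have Gm : 0 < Gamma ((x + y) / 2) by rewrite Gamma_gt0// divr_gt0// addr_gt0.
(* This [c] turns the first term on the right into the midpoint value. *)
have := Gamma_amgm x0 y0 (divr_gt0 Gm Gx).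
rewrite divfK ?gt_eqF// invf_div [Gamma x / _ * _]mulrAC => H.
rewrite expr2 -ler_pdivlMr//; move: H; lra.
Qed.

(** The substitution t = s^2 turns the integrand into twice the Gaussian. *)
Lemma Gamma_half : Gamma 2^-1 = Num.sqrt pi :> R.
Proof.
rewrite GammaE -[RHS]/(fine (Num.sqrt pi)%:E); congr fine.
have gF : measurable_fun setT (@gauss_fun R) by exact: measurable_gauss_fun.
have cg := @cvg_integral_exhausting_itv _ 1 _ isT gF (fun t _ => gauss_fun_ge0 t).
have c2 := @cvg_integral_exhausting_itv _ 2 _ isT (measurable_gamma_fun (2^-1 : R))
  (fun t _ => gamma_fun_ge0 (2^-1 : R) t).
rewrite /gamma_ereal -(cvg_lim _ c2)//; apply/cvg_lim => //.
have -> : (Num.sqrt pi)%:E = (2%:E * \int[mu]_(t in `]0%R, +oo[) (gauss_fun t)%:E)%E.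
  rewrite integral_itv_obnd_cbnd.
    by rewrite integral0y_gauss -EFinM mulrC divfK.
  by apply/measurable_EFinP; exact: measurable_funTS.
suff E n : (\int[mu]_(t in exhausting_itv 2 n) (gamma_fun 2^-1 t)%:E =
    2%:E * \int[mu]_(t in exhausting_itv 1 n) (gauss_fun t)%:E)%E.
  by under eq_fun do rewrite E; exact: cvgeZl.
rewrite /exhausting_itv expr1 -exprVn.
pose a : R := n.+1%:R^-1; rewrite -/a; pose c : R := n.+1%:R; rewrite -/c.
have a0 : 0 < a by rewrite invr_gt0.
have ac : a <= c by rewrite (@le_trans _ _ 1)// ?invf_le1 ?ler1n.
have D : derive1 (fun x : R => x ^+ 2) = (fun x => 2 * x).
  by apply/funext => x; rewrite derive1E derive_val /GRing.scale/=; ring.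
have cD : continuous (fun x : R => 2 * x).
  by move=> x; apply: cvgM; [exact: cvg_cst | exact: cvg_id].
rewrite (@integration_by_substitution_increasing _ (fun x => x ^+ 2) _ a c ac).
- rewrite D -ge0_integralZl_EFin//; last 2 first.
  + by move=> t _; rewrite lee_fin gauss_fun_ge0.
  + by apply/measurable_EFinP; exact: measurable_funTS.
  apply: eq_integral => t; rewrite inE /= in_itv/= => /andP[at_ _].
  have t0 : 0 < t by exact: lt_le_trans at_.
  rewrite -EFinM; congr EFin; rewrite /gamma_fun /gauss_fun fctE /=.
  rewrite (_ : 2^-1 - 1 = - 2^-1); last by lra.
  rewrite powRN powR12_sqrt ?sqr_ge0// sqrtr_sqr ger0_norm ?(ltW t0)//.
  by field; rewrite gt_eqF.
- move=> x y; rewrite !in_itv/= => /andP[ax _] /andP[ay _] xy.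
  by rewrite ltrXn2r ?nnegrE// (le_trans (ltW a0)).
- by move=> x _; rewrite D; exact: cD.
- rewrite D; apply/cvg_ex; exists (2 * a); apply: cvg_at_right_filter; exact: cD.
- rewrite D; apply/cvg_ex; exists (2 * c); apply: cvg_at_left_filter; exact: cD.
- split.
  + by move=> x _; exact: exprn_derivable.
  + by apply: cvg_at_right_filter; exact: exprn_continuous.
  + by apply: cvg_at_left_filter; exact: exprn_continuous.
- apply: continuous_in_subspaceT => t; rewrite inE/= in_itv/= => /andP[at_ _].
  by apply: continuous_gamma_fun; apply: lt_le_trans at_; rewrite exprn_gt0.
Qed.

End gamma.

(** * Log-convexity of Gamma and the constants it yields *)

Section gamma_asymptotics.
Context {R : realType}.
Local Notation b := (central_ratio R).
Implicit Types (x c : R) (n k : nat).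

(* [log Gamma] has nonnegative second differences, and by [Gamma_rec] its
   second difference of step 1 at [x] is [ln (x / (x - 1))], which dominates
   those of smaller steps and vanishes at infinity. *)
Definition Gamma_diff2 (h x : R) : R := Gamma (x - h) * Gamma (x + h) / Gamma x ^+ 2.

Lemma Gamma_diff2_ge1 h x : 0 <= h < x -> 1 <= Gamma_diff2 h x.
Proof.
move=> /andP[h0 hx]; have x0 : 0 < x by lra.
rewrite /Gamma_diff2 ler_pdivlMr ?exprn_gt0 ?Gamma_gt0// mul1r.
rewrite -[in X in Gamma X ^+ 2](_ : (x - h + (x + h)) / 2 = x); last by lra.
by apply: Gamma_midpoint; lra.
Qed.

(** The product of the midpoint inequalities at x - h and at x + h. *)
Lemma Gamma_diff2_half h x : 0 <= h -> 2 * h < x ->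
  Gamma_diff2 h x ^+ 2 <= Gamma_diff2 (2 * h) x.
Proof.
move=> h0 hx; have x0 : 0 < x by lra.
have Gx := Gamma_gt0 x0.
have H1 : Gamma (x - h) ^+ 2 <= Gamma (x - 2 * h) * Gamma x.
  rewrite -[in X in Gamma X ^+ 2](_ : (x - 2 * h + x) / 2 = x - h); last by lra.
  by apply: Gamma_midpoint; lra.
have H2 : Gamma (x + h) ^+ 2 <= Gamma x * Gamma (x + 2 * h).
  rewrite -[in X in Gamma X ^+ 2](_ : (x + (x + 2 * h)) / 2 = x + h); last by lra.
  by apply: Gamma_midpoint; lra.
have := ler_pM (sqr_ge0 _) (sqr_ge0 _) H1 H2.
rewrite /Gamma_diff2; move: (Gamma _) (Gamma _) (Gamma _) (Gamma _) (Gamma _) Gx.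
move=> u v w z t Gx H.
rewrite expr_div_n ler_pdivrMr ?exprn_gt0// exprMn (le_trans H)//.
by rewrite le_eqVlt; apply/orP; left; apply/eqP; field; rewrite gt_eqF.
Qed.

Lemma Gamma_diff2_1 x : 1 < x -> Gamma_diff2 1 x = x / (x - 1).
Proof.
move=> x1; rewrite /Gamma_diff2 Gamma_rec; last lra.
rewrite -[in Gamma x](subrK 1 x) (@Gamma_rec _ (x - 1)); last lra.
have G0 : 0 < Gamma (x - 1) by apply: Gamma_gt0; lra.
by field; apply/andP; split; rewrite gt_eqF//; lra.
Qed.

(** A number that is at least 1 is at most its square, and the square is bounded by the difference
    of step 1. *)
Lemma Gamma_diff2_half_le x : 1 < x -> Gamma_diff2 2^-1 x <= x / (x - 1).
Proof.
move=> x1; have H1 : 1 <= Gamma_diff2 2^-1 x by apply: Gamma_diff2_ge1; lra.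
have := @Gamma_diff2_half 2^-1 x; rewrite mulfV// Gamma_diff2_1//.
by move=> H; apply: le_trans (H _ _); [rewrite expr2 ler_peMl//; lra|lra|].
Qed.

Lemma Gamma_diff2_quarter_le x : 1 < x -> Gamma_diff2 4^-1 x <= x / (x - 1).
Proof.
move=> x1; have H1 : 1 <= Gamma_diff2 4^-1 x by apply: Gamma_diff2_ge1; lra.
apply: le_trans (Gamma_diff2_half_le x1).
have := @Gamma_diff2_half 4^-1 x; rewrite (_ : 2 * 4^-1 = 2^-1); last by lra.
by move=> H; apply: le_trans (H _ _); [rewrite expr2 ler_peMl//; lra|lra|lra].
Qed.

(** With x = c + n + 1 the upper bound x / (x - 1) is 1 + 1 / (c + n), and c >= 1/2 makes this at
    most 1 + 2 / (n + 1). *)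
Lemma cvg_Gamma_diff2 h c : (h = 2^-1 \/ h = 4^-1) -> 2^-1 <= c ->
  (fun n => Gamma_diff2 h (c + n.+1%:R)) @ \oo --> (1 : R).
Proof.
move=> hh ch.
apply: (@squeeze_cvgr _ _ _ _ (cst 1) (fun n => 1 + 2 * harmonic n)).
- apply: nearW => n /=; have n0 : 0 <= n%:R :> R by [].
  rewrite /harmonic -(natr1 n).
  have x1 : 1 < c + (n%:R + 1) by lra.
  have -> : 1 <= Gamma_diff2 h (c + (n%:R + 1)).
    by apply: Gamma_diff2_ge1; case: hh => ->; lra.
  apply: (@le_trans _ _ ((c + (n%:R + 1)) / (c + (n%:R + 1) - 1))).
    by case: hh => ->; [exact: Gamma_diff2_half_le | exact: Gamma_diff2_quarter_le].
  rewrite ler_pdivrMr; last lra.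
  rewrite -subr_ge0 (_ : _ - _ = (2 * c - 1 + n%:R) / (n%:R + 1)).
    by rewrite divr_ge0//; lra.
  by field; lra.
- exact: cvg_cst.
- rewrite -[X in _ --> X]addr0; apply: cvgD; first exact: cvg_cst.
  rewrite -[0](mulr0 2); apply: cvgM; first exact: cvg_cst.
  exact: cvg_harmonic.
Qed.

Lemma Gamma_pochhammer x k : 0 < x -> Gamma (x + k%:R) = pochhammer x k * Gamma x.
Proof.
move=> x0; elim: k => [|k IH]; first by rewrite addr0 pochhammer0 mul1r.
rewrite -(natr1 k) addrA Gamma_rec; last by rewrite ltr_wpDr.
by rewrite IH pochhammerS mulrA [_ * pochhammer _ _]mulrC.
Qed.

Lemma Gamma_half_sqr : Gamma 2^-1 ^+ 2 = pi :> R.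
Proof. by rewrite Gamma_half sqr_sqrtr// pi_ge0. Qed.

Lemma central_ratio_Gamma n :
  b n * Gamma 2^-1 * Gamma n.+1%:R = Gamma (2^-1 + n%:R).
Proof.
elim: n => [|n IH]; first by rewrite central_ratio0 addr0 Gamma1 mul1r mulr1.
rewrite -(natr1 n) addrA Gamma_rec; last by rewrite ltr_wpDr.
rewrite -IH central_ratioS -(natr1 n.+1) Gamma_rec// -(natr1 n).
move: (b n) (Gamma _) (Gamma _) => u v w.
by field; have := ler0n R n; lra.
Qed.

(** Wallis' limit: pi n b_n^2 is the inverse of [Gamma_diff2 2^-1] at n + 1/2. *)
Lemma cvg_nat_central_ratio_sqr :
  (fun n => n%:R * b n ^+ 2) @ \oo --> (pi^-1 : R).
Proof.
have pi0 : pi != 0 :> R by rewrite gt_eqF// pi_gt0.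
rewrite -cvg_shiftS /=.
have E n : n.+1%:R * b n.+1 ^+ 2 = pi^-1 * (Gamma_diff2 2^-1 (2^-1 + n.+1%:R))^-1.
  rewrite /Gamma_diff2 -(central_ratio_Gamma n.+1) (_ : _ - _ = n.+1%:R); last by lra.
  rewrite (_ : _ + _ + _ = n.+1%:R + 1); last by lra.
  rewrite -(natr1 n.+1) Gamma_rec// -Gamma_half_sqr.
  have : Gamma n.+1%:R != 0 :> R by rewrite gt_eqF// Gamma_gt0.
  have : Gamma 2^-1 != 0 :> R by rewrite gt_eqF// Gamma_gt0.
  have : n.+1%:R != 0 :> R by [].
  have : b n.+1 != 0 by rewrite gt_eqF// central_ratio_gt0.
  move: n.+1%:R (b n.+1) (Gamma (2^-1 : R)) (Gamma (n.+1%:R : R)) => w u v z u0 w0 v0 z0.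
  by field; rewrite u0 w0 v0 z0.
under eq_fun do rewrite E.
have D := @cvg_Gamma_diff2 2^-1 2^-1 (or_introl erefl) (lexx _).
have := cvgM (cvg_cst pi^-1) (cvgV (oner_neq0 R) D); rewrite invr1 mulr1.
exact.
Qed.

(** Duplication: (1/4)_n (3/4)_n = (1/2)_(2n) / 4^n, with the factorials hidden in [b]. *)
Lemma pochhammer_quarters n :
  pochhammer 4^-1 n * pochhammer (3 / 4) n * b n = b n.*2 * pochhammer 2^-1 n ^+ 2 :> R.
Proof.
elim: n => [|n IH]; first by rewrite !pochhammer0 expr1n !mul1r mulr1.
rewrite doubleS !pochhammerS (central_ratioS _ n.*2.+1) (central_ratioS _ n.*2).
rewrite (central_ratioS _ n) -(natr1 n.*2).
have -> : n.*2%:R = 2 * n%:R :> R by rewrite -mul2n natrM.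
have n0 := ler0n R n; move: n%:R n0 (pochhammer (4^-1 : R) n) (pochhammer (3 / 4 : R) n)
  (pochhammer (2^-1 : R) n)
  (b n) (b n.*2) IH => x x0 p q s u w IH.
have -> : p * (4^-1 + x) * (q * (3 / 4 + x)) * (u * ((x + 2^-1) / (x + 1))) =
    (p * q * u) * ((4^-1 + x) * (3 / 4 + x) * ((x + 2^-1) / (x + 1))) by ring.
by rewrite IH; field; lra.
Qed.

(** The reflection formula at 1/4. The square of [Gamma_diff2 4^-1] at n + 1/2 is P^2 / 2 times a
    quotient of Wallis' sequences at 2 n and [n]; these have the same limit, and the square tends to
    1. *)
Lemma Gamma_quarters : Gamma 4^-1 * Gamma (3 / 4) = pi * Num.sqrt 2 :> R.
Proof.
have pi_gt0 := @pi_gt0 R; have pi0 : pi != 0 :> R by rewrite gt_eqF.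
have G4 : 0 < Gamma 4^-1 :> R by rewrite Gamma_gt0.
have G34 : 0 < Gamma (3 / 4) :> R by rewrite Gamma_gt0.
pose P : R := Gamma 4^-1 * Gamma (3 / 4) / pi.
have P0 : 0 < P by rewrite divr_gt0// mulr_gt0.
suff P2 : P ^+ 2 = 2.
  have <- : P = Num.sqrt 2 by rewrite -P2 sqrtr_sqr gtr0_norm.
  by rewrite /P [RHS]mulrC divfK.
have D := @cvg_Gamma_diff2 4^-1 2^-1 (or_intror erefl) (lexx _).
have W := cvg_nat_central_ratio_sqr.
have W1 : (fun n => n.+1%:R * b n.+1 ^+ 2) @ \oo --> (pi^-1 : R).
  by rewrite -cvg_shiftS in W.
have W2 : (fun n => (2 * n)%:R * b (2 * n)%N ^+ 2) @ \oo --> (pi^-1 : R).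
  exact: (cvg_comp _ _ (@cvg_mulnl 2 isT) W).
rewrite -cvg_shiftS in W2.
have pi1 : pi^-1 != 0 :> R by rewrite invr_eq0.
have Q : (fun n => 2^-1 * P ^+ 2 * ((2 * n.+1)%:R * b (2 * n.+1)%N ^+ 2
    / (n.+1%:R * b n.+1 ^+ 2))) @ \oo --> 2^-1 * P ^+ 2 * (pi^-1 / pi^-1).
  by apply: cvgM; [exact: cvg_cst | exact: (cvgM W2 (cvgV pi1 W1))].
have E n : Gamma_diff2 4^-1 (2^-1 + n.+1%:R) ^+ 2 =
    2^-1 * P ^+ 2 * ((2 * n.+1)%:R * b (2 * n.+1)%N ^+ 2 / (n.+1%:R * b n.+1 ^+ 2)).
  rewrite /Gamma_diff2 (_ : _ - _ = 4^-1 + n.+1%:R); last by lra.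
  rewrite (_ : _ + _ + _ = 3 / 4 + n.+1%:R); last by lra.
  rewrite !Gamma_pochhammer//.
  have b0 : b n.+1 != 0 by rewrite gt_eqF// central_ratio_gt0.
  have := pochhammer_quarters n.+1; rewrite -mul2n => /(canRL (mulfK b0)) => H.
  rewrite mulrACA H natrM /P.
  rewrite -Gamma_half_sqr.
  have : pochhammer 2^-1 n.+1 != 0 :> R.
    by rewrite -[2^-1]subr0; exact: (pochhammer_half_neq0 0).
  have : Gamma 2^-1 != 0 :> R by rewrite gt_eqF// Gamma_gt0.
  have : n.+1%:R != 0 :> R by [].
  move: n.+1%:R (b n.+1) b0 (b (2 * n.+1)%N) (Gamma (2^-1 : R)) (pochhammer (2^-1 : R) _) {H}.
  move=> x u u0 w s p x0 s0 p0.
  by field; rewrite u0 x0 s0 p0.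
have Q1 : (fun n => 2^-1 * P ^+ 2 * ((2 * n.+1)%:R * b (2 * n.+1)%N ^+ 2
    / (n.+1%:R * b n.+1 ^+ 2))) @ \oo --> (1 : R).
  under eq_fun do rewrite -E.
  have D2 : (fun n => Gamma_diff2 4^-1 (2^-1 + n.+1%:R) ^+ 2) @ \oo --> (1 * 1 : R).
    exact: (cvgM D D).
  by rewrite mulr1 in D2.
have H : 2^-1 * P ^+ 2 * (pi^-1 / pi^-1) = 1.
  exact: (cvg_unique (@Rhausdorff R) Q Q1).
move: H; rewrite mulfV// mulr1; lra.
Qed.

(** At a = 1/2 + 2 j the factor is the square of (j + 1/2)(j + 1) / (j + 3/4)^2, which is the growth
    of [Gamma_diff2 4^-1] from 3/4 + j to 3/4 + j + 1. *)
Lemma prod_dixon_factor m :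
  \prod_(j < m) dixon_factor (2^-1 + 2 * j%:R) =
  (Gamma_diff2 4^-1 (3 / 4 + m%:R) / Gamma_diff2 4^-1 (3 / 4)) ^+ 2 :> R.
Proof.
have G x : 0 < x -> Gamma x != 0 :> R by move=> x0; rewrite gt_eqF// Gamma_gt0.
elim: m => [|m IH].
  rewrite big_ord0 addr0 mulfV ?expr1n// gt_eqF//.
  by apply: lt_le_trans (Gamma_diff2_ge1 _); lra.
rewrite big_ord_recr/= IH /dixon_factor /Gamma_diff2 -(natr1 m).
have m0 := ler0n R m.
rewrite (_ : 3 / 4 + (m%:R + 1) - 4^-1 = (3 / 4 + m%:R - 4^-1) + 1); last by lra.
rewrite (_ : 3 / 4 + (m%:R + 1) + 4^-1 = (3 / 4 + m%:R + 4^-1) + 1); last by lra.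
rewrite (_ : 3 / 4 + (m%:R + 1) = (3 / 4 + m%:R) + 1); last by lra.
rewrite (Gamma_rec (x := 3 / 4 + m%:R - 4^-1)); last lra.
rewrite (Gamma_rec (x := 3 / 4 + m%:R + 4^-1)); last lra.
rewrite (Gamma_rec (x := 3 / 4 + m%:R)); last lra.
have g1 : Gamma (3 / 4 + m%:R : R) != 0 by apply: G; lra.
have g2 : Gamma (3 / 4 : R) != 0 by apply: G; lra.
have g3 : Gamma (3 / 4 + 4^-1 : R) != 0 by apply: G; lra.
have g4 : Gamma (3 / 4 - 4^-1 : R) != 0 by apply: G; lra.
move: (Gamma _) (Gamma (3 / 4 + m%:R + 4^-1)) (Gamma (3 / 4 + m%:R))
  (Gamma (3 / 4 - 4^-1)) (Gamma (3 / 4 + 4^-1)) (Gamma (3 / 4)) g1 g2 g3 g4 m0.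
move: m%:R => y u v w s t z g1 g2 g3 g4 m0.
by field; rewrite g1 g2 g3 g4 /=; lra.
Qed.

(** Letting m grow in Dixon's product gives S = c^2 with c = Gamma (1/2) / Gamma (3/4)^2, and
    [Gamma_quarters] trades 3/4 for 1/4. *)
Lemma cvg_series_central_ratio_cube :
  series (fun n => b n ^+ 3) @ \oo -->
    (Gamma 4^-1 ^+ 4 / (4 * pi ^+ 3) : R).
Proof.
have /cvg_ex[/= S bS] := @is_cvg_series_central_ratio_cube R.
suff <- : S = Gamma 4^-1 ^+ 4 / (4 * pi ^+ 3) by [].
have H := cvg_dixon_prod bS.
pose c : R := Gamma_diff2 4^-1 (3 / 4).
have c0 : 0 < c by apply: lt_le_trans (Gamma_diff2_ge1 _); lra.
have D := @cvg_Gamma_diff2 4^-1 (3 / 4) (or_intror erefl).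
have {}D : (fun n => Gamma_diff2 4^-1 (3 / 4 + n.+1%:R)) @ \oo --> (1 : R).
  by apply: D; lra.
have H1 : (fun n => S * (Gamma_diff2 4^-1 (3 / 4 + n.+1%:R) / c) ^+ 2) @ \oo -->
    S * (1 / c * (1 / c)).
  apply: cvgM; first exact: cvg_cst.
  have Dc : (fun n => Gamma_diff2 4^-1 (3 / 4 + n.+1%:R) / c) @ \oo --> 1 / c.
    by apply: cvgM => //; exact: cvg_cst.
  exact: (cvgM Dc Dc).
have H2 : (fun n => S * (Gamma_diff2 4^-1 (3 / 4 + n.+1%:R) / c) ^+ 2) @ \oo --> (1 : R).
  rewrite -cvg_shiftS in H; move: H; under eq_fun do rewrite prod_dixon_factor.
  exact.
have E : S * (1 / c * (1 / c)) = 1 by exact: (cvg_unique (@Rhausdorff R) H1 H2).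
have -> : S = c ^+ 2.
  rewrite -[RHS]mul1r -E; field; by rewrite gt_eqF.
have G4 : Gamma 4^-1 != 0 :> R by rewrite gt_eqF// Gamma_gt0.
have pi0 : pi != 0 :> R by rewrite gt_eqF// pi_gt0.
rewrite /c /Gamma_diff2 (_ : 3 / 4 - 4^-1 = 2^-1); last by lra.
rewrite (_ : 3 / 4 + 4^-1 = 1); last by lra.
have s2 : Num.sqrt 2 ^+ 2 = 2 :> R by rewrite sqr_sqrtr.
have -> : Gamma (3 / 4) = pi * Num.sqrt 2 / Gamma 4^-1 :> R.
  by rewrite -Gamma_quarters [RHS]mulrC mulKf.
rewrite Gamma1 mulr1 expr_div_n Gamma_half_sqr -exprM.
rewrite exprMn exprMn (exprM (Num.sqrt 2) 2 2) s2.
by move: (Gamma _) pi G4 pi0 => g p g0 p0; field; rewrite g0 p0.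
Qed.

End gamma_asymptotics.

(** * Closed forms by induction on the recurrences *)

Section closed_forms.
Context {R : realType}.
Implicit Types k : nat.

Lemma cvg_series_cube k :
  series (wz_term 3 k) @ \oo -->
    (Gamma 4^-1 ^+ 2 / (2 * pi * Num.sqrt 2) *
    (Gamma (k%:R + 4^-1) /
      (Gamma (k%:R + 2^-1) ^+ 2 * Gamma (k%:R + 3 / 4))) : R).
Proof.
elim: k => [|k IH].
  rewrite !add0r Gamma_half_sqr.
  have -> : Gamma (3 / 4) = pi * Num.sqrt 2 / Gamma 4^-1 :> R.
    by rewrite -Gamma_quarters [RHS]mulrC mulKf// gt_eqF// Gamma_gt0.
  have -> : wz_term 3 0 = (fun n => central_ratio R n ^+ 3).
    by apply/funext => n; rewrite wz_term0.
  suff -> : Gamma 4^-1 ^+ 2 / (2 * pi * Num.sqrt 2) *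
      (Gamma 4^-1 / (pi * (pi * Num.sqrt 2 / Gamma 4^-1))) =
      Gamma 4^-1 ^+ 4 / (4 * pi ^+ 3) :> R by exact: cvg_series_central_ratio_cube.
  have s2 : Num.sqrt 2 ^+ 2 = 2 :> R by rewrite sqr_sqrtr.
  have G4 : Gamma 4^-1 != 0 :> R by rewrite gt_eqF// Gamma_gt0.
  have pi0 : pi != 0 :> R by rewrite gt_eqF// pi_gt0.
  have r0 : Num.sqrt 2 != 0 :> R by rewrite gt_eqF// sqrtr_gt0.
  move: (Gamma _) pi (Num.sqrt 2) G4 pi0 r0 s2 => g p s g0 p0 s0 s2.
  transitivity (g ^+ 4 / (2 * s ^+ 2 * p ^+ 3)); first by field; rewrite g0 p0 s0.
  by rewrite s2 -natrM.
rewrite [X in _ --> X](_ : _ = (k%:R + 4^-1) / ((k%:R + 2^-1) ^+ 2 * (k%:R + 3 / 4)) *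
  (Gamma 4^-1 ^+ 2 / (2 * pi * Num.sqrt 2) *
    (Gamma (k%:R + 4^-1) / (Gamma (k%:R + 2^-1) ^+ 2 * Gamma (k%:R + 3 / 4))))).
  exact: cvg_series_cube_wz.
have k0 := ler0n R k.
have rec c : 0 < c -> Gamma (k.+1%:R + c) = (k%:R + c) * Gamma (k%:R + c) :> R.
  move=> c0; rewrite -Gamma_rec; last by rewrite ltr_wpDl.
  by rewrite -(natr1 k) addrAC.
rewrite !rec//.
have G c : 0 < c -> Gamma (k%:R + c) != 0 :> R.
  by move=> c0; rewrite gt_eqF// Gamma_gt0// ltr_wpDl.
have g2 : Gamma (k%:R + 2^-1) != 0 :> R by exact: G.
have g3 : Gamma (k%:R + 3 / 4) != 0 :> R by exact: G.
move: k%:R k0 (Gamma 4^-1 ^+ 2 / _) (Gamma (k%:R + 4^-1)) (Gamma (k%:R + 2^-1))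
  (Gamma (k%:R + 3 / 4)) g2 g3 => x x0 C u v w g2 g3.
by field; rewrite g2 g3 /=; lra.
Qed.

Lemma cvg_series_sqr k : (0 < k)%N ->
  series (wz_term 2 k) @ \oo -->
    (2 ^+ (8 * k - 3) * Gamma (k%:R : R) ^+ 2 / (pi * Gamma (4 * k)%:R)).
Proof.
case: k => // k _; elim: k => [|k IH].
  have -> : 2 ^+ (8 * 1 - 3) * Gamma (1%:R : R) ^+ 2 / (pi * Gamma (4 * 1)%:R) =
     16 / 3 * pi^-1.
    rewrite Gamma1 (Gamma_nat 3) /=.
    have pi0 : pi != 0 :> R by rewrite gt_eqF// pi_gt0.
    by move: pi pi0 => p p0; rewrite (_ : 3`! = 6)//; field.
  exact: cvg_series_sqr_wz1 cvg_nat_central_ratio_sqr.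
rewrite [X in _ --> X](_ : _ = k.+1%:R /
  ((k.+1%:R + 4^-1) * (k.+1%:R + 2^-1) * (k.+1%:R + 3 / 4)) *
  (2 ^+ (8 * k.+1 - 3) * Gamma (k.+1%:R : R) ^+ 2 / (pi * Gamma (4 * k.+1)%:R))).
  exact: cvg_series_sqr_wz.
(* The 2^8 is the 4^4 taken out of (4 x)(4 x + 1)(4 x + 2)(4 x + 3), where x = k + 1; the truncated
   subtraction is exact here. *)
have -> : (8 * k.+2 - 3 = 8 + (8 * k.+1 - 3))%N by lia.
have -> : (4 * k.+2 = (4 * k.+1).+4)%N by lia.
have x0 : 0 < k.+1%:R :> R by [].
have -> : Gamma k.+2%:R = k.+1%:R * Gamma k.+1%:R :> R.
  by rewrite -(natr1 k.+1) Gamma_rec.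
have -> : Gamma (4 * k.+1).+4%:R = (4 * k.+1%:R + 3) * (4 * k.+1%:R + 2) *
    (4 * k.+1%:R + 1) * (4 * k.+1%:R) * Gamma (4 * k.+1)%:R :> R.
  have rec n : (0 < n)%N -> Gamma n.+1%:R = n%:R * Gamma n%:R :> R.
    by move=> n0; rewrite -(natr1 n) Gamma_rec// ltr0n.
  rewrite (rec (4 * k.+1).+3)// (rec (4 * k.+1).+2)// (rec (4 * k.+1).+1)//
    (rec (4 * k.+1)%N)// -(natr1 (4 * k.+1).+2) -(natr1 (4 * k.+1).+1)
    -(natr1 (4 * k.+1)) natrM; ring.
have G0 : Gamma (4 * k.+1)%:R != 0 :> R by rewrite gt_eqF// Gamma_gt0// ltr0n.
have pi0 : pi != 0 :> R by rewrite gt_eqF// pi_gt0.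
rewrite exprD; move: k.+1%:R x0 (Gamma k.+1%:R) (Gamma _) pi (2 ^+ (8 * k.+1 - 3)) G0 pi0.
move=> x x0 u v p e v0 p0.
by field; rewrite v0 p0 /=; lra.
Qed.

End closed_forms.

(** * Rational multiples *)

Section rational_multiples.
Context {R : realType}.
Variables (c : R) (w : R^nat).
Implicit Types (f g : R^nat).

(** For fixed [c] and [w] these [f] form a vector space over the rationals, in which the partial
    fractions are carried out. *)
Definition sums_rationally f := sums_to_rational_multiple (fun n => f n * w n) c.

Lemma sums_rationallyD f g :
  sums_rationally f -> sums_rationally g -> sums_rationally (fun n => f n + g n).
Proof.
move=> [q fq] [r gr]; exists (q + r).
rewrite rmorphD mulrDl.
have -> : series (fun n => (f n + g n) * w n) =
    (fun n => series (fun n => f n * w n) n + series (fun n => g n * w n) n).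
  apply/funext => n; rewrite /series/= -big_split/=.
  by apply: eq_bigr => i _; rewrite mulrDl.
exact: cvgD.
Qed.

Lemma sums_rationallyZ (a : rat) f :
  sums_rationally f -> sums_rationally (fun n => ratr a * f n).
Proof.
move=> [q fq]; exists (a * q).
rewrite rmorphM -mulrA.
have -> : series (fun n => ratr a * f n * w n) =
    (fun n => ratr a * series (fun n => f n * w n) n).
  apply/funext => n; rewrite /series/= mulr_sumr.
  by apply: eq_bigr => i _; rewrite mulrA.
by apply: cvgM => //; exact: cvg_cst.
Qed.

Lemma eq_sums_rationally f g : (forall n, f n = g n) ->
  sums_rationally f -> sums_rationally g.
Proof. by move=> fg; rewrite (_ : f = g)//; apply/funext. Qed.

(* The value at [n] of the factor ['X^2 + 'X / 2 - (m + 1) (m + 1/2)] which has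
   the roots [- (m + 1)] and [m + 1/2]. *)
Definition pair_factor (m n : nat) : R := (n%:R + m.+1%:R) * (n%:R - (m%:R + 2^-1)).

(** With y = n^2 + n / 2 and d_m = (m + 1)(m + 1/2), [pair_factor m n] is y - d_m; the gap is d_j -
    d_i, free of [n]. *)
Definition pair_gap (i j : nat) : rat :=
  j.+1%:R * (j%:R + 2^-1) - i.+1%:R * (i%:R + 2^-1).

Lemma pair_factor_neq0 m n : pair_factor m n != 0.
Proof.
have h : 2^-1 - n%:R + m%:R != 0 :> R by exact: half_sub_nat_neq0.
apply: mulf_neq0; first by rewrite gt_eqF// ltr_wpDl.
rewrite -oppr_eq0; suff -> : - (n%:R - (m%:R + 2^-1)) = 2^-1 - n%:R + m%:R :> R by [].
by lra.
Qed.

Lemma pair_gap_neq0 i j : i != j -> pair_gap i j != 0.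
Proof.
move=> ij.
have -> : pair_gap i j = (j%:R - i%:R) * (i%:R + j%:R + 3 / 2).
  by rewrite /pair_gap -(natr1 i) -(natr1 j); field.
apply: mulf_neq0; first by rewrite subr_eq0 eqr_nat eq_sym.
by rewrite gt_eqF// ltr_wpDl// addr_ge0.
Qed.

Lemma pair_factorB i j n :
  pair_factor i n - pair_factor j n = ratr (pair_gap i j).
Proof.
rewrite /pair_gap rmorphB !rmorphM !rmorphD !fmorphV !rmorph_nat /pair_factor.
by rewrite -(natr1 i) -(natr1 j); ring.
Qed.

Definition inv_pairs (s : seq nat) n : R := (\prod_(m <- s) pair_factor m n)^-1.

Lemma inv_pairs_diff i j s n : ratr (pair_gap i j) * inv_pairs (i :: j :: s) n =
  inv_pairs (j :: s) n - inv_pairs (i :: s) n.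
Proof.
have nz t : \prod_(m <- t) pair_factor m n != 0.
  by rewrite prodf_seq_neq0; apply/allP => m _; exact: pair_factor_neq0.
rewrite -(pair_factorB i j n) /inv_pairs !big_cons.
move: (pair_factor_neq0 i n) (pair_factor_neq0 j n) (nz s).
move: (pair_factor _ _) (pair_factor _ _) (\prod_(_ <- _) _) => u v p u0 v0 p0.
by field; rewrite u0 v0 p0.
Qed.

(* Partial fractions by divided differences: [inv_pairs (i :: j :: s)] is a
   rational multiple of [inv_pairs (j :: s) - inv_pairs (i :: s)]. *)
Lemma sums_inv_pairs_seq s : s != [::] -> uniq s ->
  {in s, forall m, sums_rationally (inv_pairs [:: m])} ->
  sums_rationally (inv_pairs s).
Proof.
have [k] := ubnP (size s); elim: k s => // k IH [//|i [|j s]] sk _ us H.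
  by apply: H; rewrite mem_head.
have ij : i != j by move: us => /=; rewrite inE negb_or -andbA => /andP[].
apply: (@eq_sums_rationally (fun n => ratr (pair_gap i j)^-1 *
    (inv_pairs (j :: s) n + ratr (-1) * inv_pairs (i :: s) n))).
  move=> n; rewrite rmorphN rmorph1 mulN1r -inv_pairs_diff mulrA -rmorphM mulVf.
    by rewrite rmorph1 mul1r.
  exact: pair_gap_neq0.
apply: sums_rationallyZ; apply: sums_rationallyD.
  apply: IH => //; first by move: us => /= /andP[].
  by move=> m ms; apply: H; rewrite inE ms orbT.
apply: sums_rationallyZ; apply: IH => //.
  by move: us => /=; rewrite inE negb_or => /and3P[/andP[_ ->] _ ->].
by move=> m; rewrite inE => /predU1P[->|ms]; apply: H; rewrite !inE ?eqxx ?ms ?orbT.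
Qed.

(** The entries of [s] are removed one by one: [inv_pairs_diff] expresses [inv_pairs (m :: s)] by
    [inv_pairs (m :: j :: s)] and [inv_pairs (j :: s)], and the latter is covered by
    [sums_inv_pairs_seq]. *)
Lemma sums_inv_pairs_head m s : uniq (m :: s) ->
  {in s, forall i, sums_rationally (inv_pairs [:: i])} ->
  sums_rationally (inv_pairs (m :: s)) -> sums_rationally (inv_pairs [:: m]).
Proof.
elim: s => // j s IH us H Hs.
have mj : m != j by move: us => /=; rewrite inE negb_or -andbA => /andP[].
apply: IH.
- by move: us => /=; rewrite inE negb_or => /and3P[/andP[_ ->] _ ->].
- by move=> i si; apply: H; rewrite inE si orbT.
apply: (@eq_sums_rationally (fun n => inv_pairs (j :: s) n +
    ratr (- pair_gap m j) * inv_pairs (m :: j :: s) n)).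
  by move=> n; rewrite rmorphN mulNr inv_pairs_diff opprB addrC subrK.
apply: sums_rationallyD; last exact: sums_rationallyZ.
by apply: sums_inv_pairs_seq => //; move: us => /= /andP[].
Qed.

(** Strong induction isolates each factor [m]: it is the only one in the product over [iota 0 m.+1]
    not yet known to be summable rationally. *)
Lemma sums_inv_pairs :
  (forall k, (0 < k)%N -> sums_rationally (inv_pairs (iota 0 k))) ->
  forall s, s != [::] -> uniq s -> sums_rationally (inv_pairs s).
Proof.
move=> H s s0 us; apply: sums_inv_pairs_seq => // m _ {s s0 us}.
elim/ltn_ind: m => m IH.
apply: (@sums_inv_pairs_head m (iota 0 m)).
- by rewrite /= iota_uniq andbT mem_iota ltnn.
- by move=> i; rewrite mem_iota => /andP[_]; exact: IH.
apply: (@eq_sums_rationally (inv_pairs (iota 0 m.+1))); last exact: H.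
move=> n; rewrite /inv_pairs; congr (_^-1); apply: perm_big.
by rewrite -addn1 iotaD add0n perm_catC.
Qed.

End rational_multiples.

(** * Factorization of the admissible polynomials *)

Section admissible_polynomials.
Implicit Types (p q : {poly rat}) (m : nat).

Definition pair_poly m : {poly rat} :=
  ('X - (- m.+1%:R)%:P) * ('X - (m%:R + 2^-1)%:P).

Local Notation sym := (- (2^-1)%:P - 'X : {poly rat}).
Local Notation toC := (map_poly (ratr : rat -> algC)).

Lemma pair_poly_monic m : pair_poly m \is monic.
Proof. by rewrite monicMl monicXsubC. Qed.

Lemma pair_poly_sym m : pair_poly m \Po sym = pair_poly m.
Proof.
rewrite /pair_poly comp_polyM !comp_polyB !comp_polyX !comp_polyC.
have -> : (- m.+1%:R)%:P = - (m%:R)%:P - (2^-1)%:P - (2^-1)%:P :> {poly rat}.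
  by rewrite -!polyCN -!polyCD -(natr1 m); congr (_%:P); field.
by rewrite polyCD; ring.
Qed.

Lemma horner_sym q x : (q \Po sym).[x] = q.[- 2^-1 - x].
Proof. by rewrite horner_comp !hornerE. Qed.

Lemma root_sym q x : q = q \Po sym -> root q x -> root q (- 2^-1 - x).
Proof.
by move=> qs /rootP qx; apply/rootP; rewrite {1}qs horner_sym subKr.
Qed.

Lemma admissible_root_rat (z : algC) : admissible_root z ->
  exists m, z = ratr (- m.+1%:R) \/ z = ratr (m%:R + 2^-1).
Proof.
by move=> [[m ->]|[m ->]]; exists m; [left|right];
  rewrite ?rmorphN ?rmorphD ?fmorphV ?rmorph_nat.
Qed.

(** A nonconstant [p] has a complex root; being admissible it is rational, and the symmetry supplies
    the other root of the pair. *)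
Lemma pair_poly_dvd p : simple_admissible_roots p -> p = p \Po sym ->
  size p != 1%N -> exists m q, p = pair_poly m * q.
Proof.
move=> Hp ps sp.
have /closed_rootP[z pz] : size (toC p) != 1%N by rewrite size_map_poly.
have [_ /admissible_root_rat[m zm]] := Hp z pz.
have [r1 r2] : root p (- m.+1%:R) /\ root p (m%:R + 2^-1).
  case: zm pz => ->; rewrite fmorph_root => r; split=> //; have := root_sym ps r.
    suff -> : - 2^-1 - - m.+1%:R = m%:R + 2^-1 :> rat by [].
    by rewrite -(natr1 m); field.
  suff -> : - 2^-1 - (m%:R + 2^-1) = - m.+1%:R :> rat by [].
  by rewrite -(natr1 m); field.
move: r1 => /factor_theorem[q1 p1]; move: r2; rewrite {1}p1 rootM root_XsubC.
(* The two roots have opposite signs, so the second one is a root of the cofactor. *)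
have -> : (m%:R + 2^-1 == - m.+1%:R :> rat) = false.
  apply/negbTE; rewrite -subr_eq0 opprK gt_eqF// ltr_wpDl//.
rewrite orbF => /factor_theorem[q q1E]; exists m, q.
by rewrite p1 q1E /pair_poly -mulrA mulrC; congr (_ * _); rewrite mulrC.
Qed.

Lemma admissible_polyP p : p \is monic -> simple_admissible_roots p ->
  p = p \Po sym -> exists2 s, uniq s & p = \prod_(m <- s) pair_poly m.
Proof.
have [n] := ubnP (size p); elim: n p => // n IH p pn pm Hp ps.
have [/eqP/size_poly1P[a a0 pa]|sp] := eqVneq (size p) 1%N.
  exists [::] => //; rewrite big_nil; move: pm; rewrite pa monicE lead_coefC.
  by move=> /eqP ->.
have [m [q pq]] := pair_poly_dvd Hp ps sp.
have pair0 := monic_neq0 (pair_poly_monic m).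
have qm : q \is monic by rewrite pq monicMl ?pair_poly_monic in pm.
have q0 := monic_neq0 qm.
have qn : (size q < n)%N.
  have pair3 : size (pair_poly m) = 3%N.
    by rewrite /pair_poly size_mul ?polyXsubC_eq0// !size_XsubC.
  by move: pn; rewrite pq size_mul// pair3 !addSn add0n /= ltnS; exact: ltnW.
have qs : q = q \Po sym.
  by move: ps; rewrite pq comp_polyM pair_poly_sym => /(mulfI pair0).
have mupE z : mup z (toC p) = (mup z (toC (pair_poly m)) + mup z (toC q))%N.
  by rewrite pq rmorphM mupM// map_poly_eq0.
have mup_root z r : r != 0 -> (0 < mup z (toC r))%N = root (toC r) z.
  by move=> r0; rewrite -XsubC_dvd ?map_poly_eq0// dvdp_XsubCl.
(* Multiplicities add up, and a root of [q] already contributes the whole multiplicity 1 there. *)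
have Hq : simple_admissible_roots q.
  move=> z qz; have pz : root (toC p) z by rewrite pq rmorphM rootM qz orbT.
  have [p1 az] := Hp z pz; split=> //.
  by move: qz; rewrite -mup_root// => qz; move: p1; rewrite mupE; lia.
have [s us qE] := IH q qn qm Hq qs.
exists (m :: s); last by rewrite big_cons -qE.
(* A repeated [m] would give - (m + 1) multiplicity at least 2 in [p]. *)
rewrite /= us andbT; apply/negP => ms.
pose z : algC := ratr (- m.+1%:R).
have rz : root (toC (pair_poly m)) z.
  by rewrite fmorph_root /pair_poly rootM root_XsubC eqxx.
have qz : root (toC q) z.
  by rewrite fmorph_root qE (big_rem m)//= rootM /pair_poly rootM root_XsubC eqxx.
have pz : root (toC p) z by rewrite pq rmorphM rootM qz orbT.
have [] := Hp z pz; rewrite mupE.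
by move: rz qz; rewrite -!mup_root//; lia.
Qed.

End admissible_polynomials.

(** * Matching polynomial values with the series of (i) *)

Section evaluation.
Context {R : realType}.

Lemma ratr_pair_poly m n : ratr (pair_poly m).[n%:R] = pair_factor m n :> R.
Proof.
rewrite /pair_poly /pair_factor hornerM !hornerXsubC rmorphM !rmorphB rmorphN.
by rewrite rmorphD fmorphV !rmorph_nat opprK.
Qed.

Lemma inv_pairs_pair_poly s n :
  (ratr (\prod_(m <- s) pair_poly m).[n%:R])^-1 = inv_pairs s n :> R.
Proof.
rewrite /inv_pairs horner_prod rmorph_prod; congr (_^-1).
by apply: eq_bigr => m _; exact: ratr_pair_poly.
Qed.

(** Factors of equal index are paired; the sign arises since 1/2 - n + m is the opposite of n - (m +
    1/2). *)
Lemma pochhammer_pairs k n :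
  pochhammer (n%:R + 1) k * pochhammer (2^-1 - n%:R) k =
  (-1) ^+ k * \prod_(m <- iota 0 k) pair_factor m n :> R.
Proof.
elim: k => [|k IH]; first by rewrite !pochhammer0 big_nil.
rewrite !pochhammerS mulrACA IH -[in RHS](addn1 k) iotaD big_cat big_seq1/= add0n.
by rewrite exprD /pair_factor -(natr1 k); ring.
Qed.

Lemma wz_term_inv_pairs j k n :
  wz_term j k n = (-1) ^+ k * inv_pairs (iota 0 k) n * central_ratio R n ^+ j.
Proof.
by rewrite /wz_term pochhammer_pairs invfM invr_sign [RHS]mulrC.
Qed.

Lemma sums_inv_pairs_iota j k (c : R) : sums_to_rational_multiple (wz_term j k) c ->
  sums_rationally c (fun n => central_ratio R n ^+ j) (inv_pairs (iota 0 k)).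
Proof.
move=> H; apply: (@eq_sums_rationally _ _ _
  (fun n => ratr ((-1) ^+ k) * ((-1) ^+ k * inv_pairs (iota 0 k) n))).
  by move=> n; rewrite rmorphXn rmorphN rmorph1 mulrA -expr2 sqrr_sign mul1r.
apply: sums_rationallyZ; rewrite /sums_rationally.
suff -> : (fun n => (-1) ^+ k * inv_pairs (iota 0 k) n * central_ratio R n ^+ j) =
    wz_term j k by [].
by apply/funext => n; rewrite wz_term_inv_pairs.
Qed.

(** The recurrence has rational coefficients; at k = 0 the multiple is 2, as the sum is Gamma
    (1/4)^4 / (4 pi^3). *)
Lemma sums_wz_cube k :
  sums_to_rational_multiple (wz_term 3 k) (Gamma (4^-1 : R) ^+ 4 / (8 * pi ^+ 3)).
Proof.
elim: k => [|k [q IH]].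
  exists 2; have -> : wz_term 3 0 = (fun n => central_ratio R n ^+ 3).
    by apply/funext => n; rewrite wz_term0.
  rewrite rmorph_nat (_ : 2 * _ = Gamma 4^-1 ^+ 4 / (4 * pi ^+ 3)).
    exact: cvg_series_central_ratio_cube.
  have pi0 : pi != 0 :> R by rewrite gt_eqF// pi_gt0.
  by move: (Gamma _) pi pi0 => g p p0; field.
exists ((k%:R + 4^-1) / ((k%:R + 2^-1) ^+ 2 * (k%:R + 3 / 4)) * q).
rewrite rmorphM -[X in _ --> X]mulrA; have := cvg_series_cube_wz IH.
by rewrite !(rmorph_nat, fmorphV, rmorphM, rmorphXn, rmorphD).
Qed.

Lemma sums_wz_sqr k : (0 < k)%N -> sums_to_rational_multiple (wz_term 2 k) (pi^-1 : R).
Proof.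
case: k => // k _; elim: k => [|k [q IH]].
  exists (16 / 3); rewrite rmorphM fmorphV !rmorph_nat.
  exact: cvg_series_sqr_wz1 cvg_nat_central_ratio_sqr.
exists (k.+1%:R / ((k.+1%:R + 4^-1) * (k.+1%:R + 2^-1) * (k.+1%:R + 3 / 4)) * q).
rewrite rmorphM -[X in _ --> X]mulrA; have := cvg_series_sqr_wz (ltn0Sn k) IH.
by rewrite !(rmorph_nat, fmorphV, rmorphM, rmorphXn, rmorphD).
Qed.

End evaluation.

(** For the squares in (ii) the degree is positive: p = 1 would give the divergent series of
    b_n^2. *)
Theorem theorem2 (R : realType) :
  (forall k : nat, (1 <= k)%N ->
     series (fun n : nat => central_ratio R n ^+ 3 /
         (pochhammer (n%:R + 1) k * pochhammer (2^-1 - n%:R) k)) @ \oo -->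
       Gamma (4^-1 : R) ^+ 2 / (2 * pi * Num.sqrt 2) *
       (Gamma (k%:R + 4^-1) /
          (Gamma (k%:R + 2^-1) ^+ 2 * Gamma (k%:R + 3 / 4)))
     /\
     series (fun n : nat => central_ratio R n ^+ 2 /
         (pochhammer (n%:R + 1) k * pochhammer (2^-1 - n%:R) k)) @ \oo -->
       2 ^+ (8 * k - 3) * Gamma (k%:R : R) ^+ 2 /
       (pi * Gamma (4 * k)%:R))
  /\
  (forall p : {poly rat},
     p \is monic ->
     ~~ odd (size p).-1 ->
     simple_admissible_roots p ->
     p = p \Po (- (2^-1)%:P - 'X) ->
     sums_to_rational_multiple
       (fun n : nat => (ratr p.[n%:R])^-1 * central_ratio R n ^+ 3)
       (Gamma (4^-1 : R) ^+ 4 / (8 * pi ^+ 3))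
     /\
     ((0 < (size p).-1)%N ->
      sums_to_rational_multiple
        (fun n : nat => (ratr p.[n%:R])^-1 * central_ratio R n ^+ 2)
        (pi^-1 : R))).
Proof.
split=> [k k1|p pm _ Hp ps].
  by split; [exact: cvg_series_cube | exact: cvg_series_sqr].
have [s us pE] := admissible_polyP pm Hp ps.
have E (j : nat) : (fun n => (ratr p.[n%:R])^-1 * central_ratio R n ^+ j) =
    (fun n => inv_pairs s n * central_ratio R n ^+ j).
  by apply/funext => n; rewrite pE inv_pairs_pair_poly.
rewrite !E; split=> [|sp].
  (* The empty product p = 1 is the case k = 0 of the cubes. *)
  have [s0|s0] := eqVneq s [::]; last first.
    apply: (@sums_inv_pairs _ _ (fun n => central_ratio R n ^+ 3)) => // k _.
    exact/sums_inv_pairs_iota/sums_wz_cube.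
  rewrite s0; exact: sums_inv_pairs_iota (sums_wz_cube 0).
apply: (@sums_inv_pairs _ _ (fun n => central_ratio R n ^+ 2)) => //.
  by move=> k k0; exact/sums_inv_pairs_iota/sums_wz_sqr.
by apply: contraTneq sp => s0; rewrite pE s0 big_nil size_poly1.
Qed.
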